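(* Let $M$ and $N$ be positroids with no loops, and let $T=E(M)\cap E(N)$. If $T$ is nonempty, $T$ is independent in both $M$ and $N$, and $T$ is a set of clones in both $M$ and $N$, then the free amalgam of $M$ and $N$ exists and is a positroid.
   Context: A matroid $M$ of rank $r$ on $n$ elements is a positroid if there is a linear order on $E(M)$ and an $r\times n$ real matrix whose columns, in that order, represent $M$ and all of whose $r\times r$ minors are nonnegative. Elements $e,f$ of a matroid are clones if the transposition exchanging them is an automorphism; a set of clones is a set any two distinct elements of which are clones. An amalgam of $M$ and $N$ is a matroid $K$ on $E(M)\cup E(N)$ with $K|E(M)=M$ and $K|E(N)=N$; the free amalgam is an amalgam $K$ such that every set that is independent in some amalgam of $M$ and $N$ is independent in $K$. *)

(* Defs.v *)
From HB Require Import structures.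
From mathcomp Require Import all_boot all_order all_fingroup all_algebra.
From mathcomp Require Import reals.

Set Implicit Arguments.
Unset Strict Implicit.
Unset Printing Implicit Defensive.

Import Order.TTheory GRing.Theory Num.Theory.
Local Open Scope ring_scope.

Section Matroids.
Variable U : finType.
Implicit Types (E I J X : {set U}) (F : {set {set U}}).

Definition matroid_axiom E F : bool :=
  [&& set0 \in F,
      [forall I in F, I \subset E],
      [forall I in F, forall J : {set U}, (J \subset I) ==> (J \in F)]
    & [forall I in F, forall J in F,
         (#|I| < #|J|)%N ==> [exists x in J :\: I, x |: I \in F]]].

(* Ground sets are subsets of an ambient finite type U, so that two matroids
   may have overlapping ground sets.  The axioms are boolean, so Leibniz
   equality of matroids is equality of ground sets and of independent sets
   (matroid_inj below). *)
Record matroid := Matroid {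
  ground : {set U};
  indep : {set {set U}};
  matroidP : matroid_axiom ground indep }.

Implicit Types (M N K : matroid).

Lemma matroid_inj M N : ground M = ground N -> indep M = indep N -> M = N.
Proof.
case: M N => [E F p] [E' F' p'] /= eqE eqF.
by subst; congr Matroid; apply: bool_irrelevance.
Qed.

Definition rank M : nat := \max_(I in indep M) #|I|.

Definition is_loop M (e : U) : Prop := e \in ground M /\ [set e] \notin indep M.

Definition loopless M : Prop := forall e : U, ~ is_loop M e.

Lemma restrict_axiom M X :
  matroid_axiom (ground M :&: X) [set I in indep M | I \subset X].
Proof.
case: M => E F /= /and4P[F0 /forall_inP FE /forall_inP Fd /forall_inP Fa].
apply/and4P; split.
- by rewrite inE F0 sub0set.
- by apply/forall_inP => I; rewrite inE subsetI => /andP[/FE -> ->].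
- apply/forall_inP => I; rewrite inE => /andP[IF IX].
  apply/forallP => J; apply/implyP => JI; rewrite inE (subset_trans JI IX) andbT.
  by move/forallP/(_ J)/implyP: (Fd I IF); apply.
- apply/forall_inP => I; rewrite inE => /andP[IF IX].
  apply/forall_inP => J; rewrite inE => /andP[JF JX]; apply/implyP => ltIJ.
  move/forall_inP/(_ J JF)/implyP/(_ ltIJ)/exists_inP: (Fa I IF) => [x xJI xIF].
  apply/exists_inP; exists x => //; rewrite inE xIF subUset IX andbT sub1set.
  by move: xJI; rewrite inE => /andP[_]; apply: (subsetP JX).
Qed.

Definition restrict M X : matroid := Matroid (restrict_axiom M X).

(* Automorphisms are given by permutations of the ambient type U that preserve
   the ground set; only their action on the ground set matters. *)
Definition is_automorphism M (s : {perm U}) : Prop :=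
  s @: ground M = ground M /\
  forall I, I \subset ground M -> (s @: I \in indep M) = (I \in indep M).

Definition clones M (e f : U) : Prop :=
  [/\ e \in ground M, f \in ground M & is_automorphism M (tperm e f)].

Definition clone_set M X : Prop :=
  X \subset ground M /\
  forall e f : U, e \in X -> f \in X -> e != f -> clones M e f.

Definition is_amalgam M N K : Prop :=
  [/\ ground K = ground M :|: ground N,
      restrict K (ground M) = M
    & restrict K (ground N) = N].

Definition is_free_amalgam M N K : Prop :=
  is_amalgam M N K /\
  forall K', is_amalgam M N K' -> forall I, I \in indep K' -> I \in indep K.

(* The linear order on the ground set is given by its increasing enumeration
   s, and column j of A represents the element tnth s j.  Column sets J are
   sets of positions, so parallel elements (equal columns) are told apart. *)
Definition represents (R : fieldType) (M : matroid) (m n : nat)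
    (s : n.-tuple U) (A : 'M[R]_(m, n)) : Prop :=
  forall J : {set 'I_n},
    ([set tnth s j | j in J] \in indep M) = free [seq col j A | j in J].

Definition maximal_minors_nonneg (R : realType) (r n : nat)
    (A : 'M[R]_(r, n)) : Prop :=
  forall f : 'I_r -> 'I_n, {homo f : i j / (i < j)%N} ->
    0 <= \det (colsub f A).

Definition positroid (R : realType) (M : matroid) : Prop :=
  exists (s : #|ground M|.-tuple U) (A : 'M[R]_(rank M, #|ground M|)),
    [/\ uniq s, [set x in s] = ground M, represents M s A
      & maximal_minors_nonneg A].

End Matroids.

(* Main.v *)
Require Import Defs.
From HB Require Import structures.
From mathcomp Require Import all_boot all_order all_fingroup all_algebra.
From mathcomp Require Import reals.
From mathcomp Require Import zify ring.

(** The matroid of a matrix with nonnegative maximal minors is noncrossing for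
    the column order: by the three-term Pluecker relation, if S+a+b and S+c+d are
    bases and a, b, c, d are in cyclic order, then S+a+c is a basis.
    Conversely every noncrossing matroid has such a matrix, by induction on the
    number of bases.  Away from loops and coloops, choose an element e in the
    closure of a shortest interval following it, and let f be the next element.
    Sliding f along the line spanned by e and f until it meets the span of the
    rest Z of the interval yields a noncrossing matroid with fewer bases, from
    which M is recovered by adding a multiple of column e to column f.

    Hence positroids can be handled combinatorially.  Clones may be moved next to
    each other without creating a crossing, so we may order the ground sets as
    E(M) - T, T and T, E(N) - T.  In the free amalgam, a set I is independent if
    and only if its parts A in E(M) - T and C in E(N) - T are independent and
    |I| + |T| <= r_M(A + T) + r_N(C + T).  In the order E(M) - T, T, E(N) - T,
    a crossing of the amalgam restricts to a crossing of M or of N in which the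
    elements outside E(M) (or E(N)) are replaced by a clone in T. *)

(** The multiple of column [e] need not be small. Up to loops and coloops [f] is the next element,
    so with the right sign a maximal minor of the new matrix that involves [f] is a sum of two
    nonnegative minors of the old one. Nothing cancels, and the nonzero minors are exactly the bases
    of M. The sign depends on the coloops skipped and on whether the step passes the end of the
    order. The hard point is that sliding yields a matroid at all: its bases are those of M minus a
    family, and exchange for the remainder is where the minimality of the interval is spent. The
    inequality for the free amalgam is forced: in any amalgam, A + T and C + T have union containing
    I and intersection containing the independent set T, so submodularity gives it. Clones supply
    the converse on each side, since for them only the number of elements taken from T matters. *)

Set Implicit Arguments.
Unset Strict Implicit.
Unset Printing Implicit Defensive.

Import Order.TTheory GRing.Theory Num.Theory.

(** * Rank and closure *)

Section Rank.
Variables (U : finType) (M : matroid U).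
Implicit Types (A B E I J X Y Z : {set U}) (x y z : U).

Lemma indep0 : set0 \in indep M.
Proof. by case/and4P: (matroidP M). Qed.

Lemma indep_ground I : I \in indep M -> I \subset ground M.
Proof. by case/and4P: (matroidP M) => _ /forall_inP h _ _ /h. Qed.

Lemma indepS I J : J \subset I -> I \in indep M -> J \in indep M.
Proof.
case/and4P: (matroidP M) => _ _ /forall_inP h _ JI /h.
by move/forallP/(_ J)/implyP; apply.
Qed.

Lemma indep_aug I J : I \in indep M -> J \in indep M -> (#|I| < #|J|)%N ->
  exists2 x, x \in J :\: I & x |: I \in indep M.
Proof.
case/and4P: (matroidP M) => _ _ _ /forall_inP h /h /forall_inP h2 /h2 /implyP h3.
by move/h3/exists_inP.
Qed.

Definition rk X : nat := \max_(I in indep M | I \subset X) #|I|.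

Lemma leq_rk I X : I \in indep M -> I \subset X -> (#|I| <= rk X)%N.
Proof.
move=> hI IX.
apply: (@leq_bigmax_cond _ (fun J => (J \in indep M) && (J \subset X))
  (fun J : {set U} => #|J|)).
by rewrite hI.
Qed.

Lemma rk_indep I X : I \in indep M -> I \subset X ->
  exists J, [/\ J \in indep M, I \subset J, J \subset X & #|J| = rk X].
Proof.
move=> hI IX.
have [|J0] := @eq_bigmax_cond _ (fun J => (J \in indep M) && (J \subset X))
  (fun J : {set U} => #|J|).
  by apply/card_gt0P; exists set0; rewrite unfold_in /= indep0 sub0set.
rewrite unfold_in /= => /andP[hJ0 J0X] eJ0.
have {}eJ0 : rk X = #|J0| by rewrite -eJ0.
move: {2}(#|X| - #|I|)%N (leqnn (#|X| - #|I|)) => k.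
elim: k I hI IX => [|k IH] I hI IX le_k.
  exists I; split=> //; apply/eqP; rewrite eqn_leq leq_rk //=.
  have: (rk X <= #|X|)%N by rewrite eJ0 subset_leq_card.
  lia.
have := leq_rk hI IX; rewrite leq_eqVlt => /predU1P[eI|ltI].
  by exists I; split.
rewrite eJ0 in ltI; have [x xJI hxI] := indep_aug hI hJ0 ltI.
have [xJ xI] := setDP xJI.
have xIX : x |: I \subset X by rewrite subUset sub1set IX (subsetP J0X).
case: (IH (x |: I) hxI xIX).
  rewrite cardsU1 xI /=; have := subset_leq_card J0X; lia.
move=> J [hJ xIJ JX eJ]; exists J; split=> //.
by apply: subset_trans xIJ; apply: subsetUr.
Qed.

Lemma rk_le_card X : (rk X <= #|X|)%N.
Proof.
have [J [_ _ JX <-]] := rk_indep indep0 (sub0set X).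
exact: subset_leq_card.
Qed.

Lemma rkS X Y : X \subset Y -> (rk X <= rk Y)%N.
Proof.
move=> XY; have [J [hJ _ JX <-]] := rk_indep indep0 (sub0set X).
by apply: leq_rk => //; apply: subset_trans XY.
Qed.

Lemma indepE I : (I \in indep M) = (rk I == #|I|).
Proof.
apply/idP/eqP => [hI|eI].
  by apply/eqP; rewrite eqn_leq rk_le_card leq_rk.
have [J [hJ _ JI eJ]] := rk_indep indep0 (sub0set I).
suff -> : I = J by [].
by apply/eqP; rewrite eq_sym eqEcard JI -eI eJ /=.
Qed.

Lemma rk_submod X Y : (rk (X :|: Y) + rk (X :&: Y) <= rk X + rk Y)%N.
Proof.
have [I [hI _ IXY eI]] := rk_indep indep0 (sub0set (X :&: Y)).
have IU : I \subset X :|: Y.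
  by apply: subset_trans IXY _; apply: subset_trans (subsetIl _ _) (subsetUl _ _).
have [J [hJ IJ JU eJ]] := rk_indep hI IU.
rewrite -eI -eJ.
have hX : (#|J :&: X| <= rk X)%N by rewrite leq_rk ?subsetIr // (indepS _ hJ) ?subsetIl.
have hY : (#|J :&: Y| <= rk Y)%N by rewrite leq_rk ?subsetIr // (indepS _ hJ) ?subsetIl.
have eJ2 : J = (J :&: X) :|: (J :&: Y) by rewrite -setIUr; apply/esym/setIidPl.
have sI : I \subset (J :&: X) :&: (J :&: Y).
  by rewrite setIACA setIid subsetI IJ.
have := cardsUI (J :&: X) (J :&: Y); rewrite -eJ2.
have := subset_leq_card sI; lia.
Qed.

Lemma rkU1 x X : (rk (x |: X) <= (rk X).+1)%N.
Proof.
have := rk_submod [set x] X; have := rk_le_card [set x]; rewrite cards1; lia.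
Qed.

Lemma rkU X Y : (rk (X :|: Y) <= rk X + #|Y|)%N.
Proof. have := rk_submod X Y; have := rk_le_card Y; lia. Qed.

Definition cl X : {set U} := [set x | rk (x |: X) == rk X].

Lemma in_cl x X : (x \in cl X) = (rk (x |: X) == rk X).
Proof. by rewrite inE. Qed.

Lemma sub_cl X : X \subset cl X.
Proof.
by apply/subsetP => x xX; rewrite in_cl; apply/eqP; congr rk; apply/setUidPr; rewrite sub1set.
Qed.

Lemma mem_cl x X : x \in X -> x \in cl X.
Proof. exact: (subsetP (sub_cl X)). Qed.

Lemma notin_clE x X : (x \notin cl X) = (rk (x |: X) == (rk X).+1).
Proof.
rewrite in_cl; have := rkU1 x X; have := rkS (subsetUr [set x] X); lia.
Qed.

Lemma clS X Y : X \subset Y -> cl X \subset cl Y.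
Proof.
move=> XY; apply/subsetP => x; rewrite !in_cl => /eqP eX.
have [xY|xY] := boolP (x \in Y).
  by apply/eqP; congr rk; apply/setUidPr; rewrite sub1set.
have := rk_submod (x |: X) Y.
have -> : (x |: X) :|: Y = x |: Y by rewrite -setUA (setUidPr XY).
have sX : X \subset (x |: X) :&: Y by rewrite subsetI subsetUr XY.
have := rkS sX; have := rkS (subsetUr [set x] Y); lia.
Qed.

Lemma mem_clS x X Y : X \subset Y -> x \in cl X -> x \in cl Y.
Proof. by move=> /clS/subsetP; apply. Qed.

Lemma rk_span X Y : Y \subset cl X -> rk (X :|: Y) = rk X.
Proof.
have [n] := ubnP #|Y|; elim: n Y => // n IH Y /ltnSE leYn YX.
have [->|[y yY]] := set_0Vmem Y; first by rewrite setU0.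
have YyX : Y :\ y \subset cl X := subset_trans (subsetDl _ _) YX.
rewrite -(IH _ _ YyX); last by rewrite (cardsD1 y) yY in leYn.
rewrite -{1}(setD1K yY) setUCA; apply/eqP; rewrite -in_cl.
by apply: (mem_clS (subsetUl _ _)); apply: (subsetP YX).
Qed.

Lemma rk_spanS X Y : Y \subset cl X -> (rk Y <= rk X)%N.
Proof. by move=> /rk_span <-; apply: rkS; apply: subsetUr. Qed.

Lemma rk_cl X : rk (cl X) = rk X.
Proof.
by apply/eqP; rewrite eqn_leq rk_spanS //= rkS // sub_cl.
Qed.

Lemma cl_idem X : cl (cl X) = cl X.
Proof.
apply/eqP; rewrite eqEsubset sub_cl andbT; apply/subsetP => x.
rewrite !in_cl rk_cl => /eqP e.
have := rkS (setUS [set x] (sub_cl X)); have := rkS (subsetUr [set x] X); lia.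
Qed.

Lemma cl_sub X Y : Y \subset cl X -> cl Y \subset cl X.
Proof. by rewrite -{2}(cl_idem X); apply: clS. Qed.

Lemma mem_cl_trans x X Y : x \in cl Y -> Y \subset cl X -> x \in cl X.
Proof. by move=> xY /cl_sub/subsetP; apply. Qed.

Lemma cl_exchange x y X : x \in cl (y |: X) -> x \notin cl X -> y \in cl (x |: X).
Proof.
rewrite notin_clE !in_cl (setUCA [set y]) => /eqP e1 /eqP e2.
have := rkU1 y X; have := rkS (subsetUr [set y] (x |: X)).
by rewrite setUCA e1 e2; lia.
Qed.

Lemma span_rk X Y : X \subset Y -> (rk Y <= rk X)%N -> Y \subset cl X.
Proof.
move=> XY le; apply/subsetP => y yY; rewrite in_cl.
have sy : y |: X \subset Y by rewrite subUset sub1set yY.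
have := rkS sy; have := rkS (subsetUr [set y] X); lia.
Qed.

Lemma rk_cards I : I \in indep M -> rk I = #|I|.
Proof. by rewrite indepE => /eqP. Qed.

Lemma cl_basis_eq I J : I \in indep M -> J \in indep M -> I \subset cl J ->
  #|J| <= #|I| -> cl J \subset cl I.
Proof.
by move=> hI hJ IJ le; apply: span_rk; rewrite // rk_cl !rk_cards.
Qed.

Lemma indepU1 x I : I \in indep M -> x \notin I ->
  (x |: I \in indep M) = (x \notin cl I).
Proof.
move=> hI xI; rewrite indepE notin_clE cardsU1 xI.
by move: hI; rewrite indepE => /eqP ->.
Qed.

Lemma indep_notin_cl x I : x |: I \in indep M -> x \notin I -> x \notin cl I.
Proof. by move=> hxI xI; rewrite -indepU1 // (indepS _ hxI) // subsetUr. Qed.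

(** An element spanned by an independent set has a unique smallest spanning subset there, given by
    its fundamental circuit. *)
Lemma cl_indepI I A B x : I \in indep M -> A \subset I -> B \subset I ->
  x \in cl A -> x \in cl B -> x \in cl (A :&: B).
Proof.
move=> hI AI BI; have [xAB|xAB] := boolP (x \in A :&: B); first by rewrite (mem_cl xAB).
rewrite !in_cl => /eqP eA /eqP eB.
have := rk_submod (x |: A) (x |: B); rewrite -setUUr -setUIr eA eB.
have hAB : A :|: B \in indep M by apply: indepS hI; rewrite subUset AI.
rewrite (rk_cards (indepS AI hI)) (rk_cards (indepS BI hI)).
rewrite (rk_cards (indepS (subset_trans (subsetIl A B) AI) hI)).
have := rkS (subsetUr [set x] (A :|: B)); rewrite (rk_cards hAB).
have := rkS (subsetUr [set x] (A :&: B)).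
rewrite (rk_cards (indepS (subset_trans (subsetIl A B) AI) hI)).
have := cardsUI A B; lia.
Qed.

Lemma rk_setT : rk setT = rank M.
Proof.
rewrite /rk /rank; apply: eq_bigl => I; by rewrite subsetT andbT.
Qed.

Lemma rk_le_rank X : (rk X <= rank M)%N.
Proof. by rewrite -rk_setT rkS ?subsetT. Qed.

Definition bases : {set {set U}} := [set B in indep M | #|B| == rank M].

Lemma basesP B : reflect (B \in indep M /\ #|B| = rank M) (B \in bases).
Proof. by rewrite inE; apply: (iffP andP) => -[hB /eqP]. Qed.

Lemma bases_indep B : B \in bases -> B \in indep M.
Proof. by case/basesP. Qed.

Lemma bases_card B : B \in bases -> #|B| = rank M.
Proof. by case/basesP. Qed.

Lemma bases_ext I : I \in indep M -> exists2 B, B \in bases & I \subset B.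
Proof.
move=> hI; have [J [hJ IJ _ eJ]] := rk_indep hI (subsetT I).
by exists J => //; apply/basesP; rewrite -rk_setT.
Qed.

Lemma basesU1 x I : I \in indep M -> (#|I|.+1 = rank M)%N ->
  (x |: I \in bases) = (x \notin cl I).
Proof.
move=> hI eI; have [xI|xI] := boolP (x \in I).
  rewrite (mem_cl xI) /=; apply/negP => /bases_card.
  by rewrite cardsU1 xI; lia.
rewrite -(indepU1 hI xI) inE cardsU1 xI add1n eI eqxx andbT //.
Qed.

Lemma basesD1 x B : B \in bases -> x \in B -> 
  [/\ B :\ x \in indep M, (#|B :\ x|.+1 = rank M)%N & x \notin cl (B :\ x)].
Proof.
move=> /basesP[hB eB] xB; split; first by rewrite (indepS _ hB) ?subsetDl.
  by rewrite -eB [RHS](cardsD1 x) xB.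
by apply: indep_notin_cl; rewrite ?setD1K // !inE eqxx.
Qed.

Lemma bases_exchange B1 B2 x : B1 \in bases -> B2 \in bases -> x \in B1 :\: B2 ->
  exists2 y, y \in B2 :\: B1 & y |: (B1 :\ x) \in bases.
Proof.
move=> hB1 hB2 /setDP[xB1 xB2]; have [hI eI xcl] := basesD1 hB1 xB1.
have [|y /setDP[yB2 yB1] hy] := indep_aug hI (bases_indep hB2).
  by rewrite (bases_card hB2) -eI.
exists y.
  rewrite inE yB2 andbT; apply: contra yB1 => yB1; rewrite !inE yB1 andbT.
  by apply: contraNneq xB2 => <-.
by rewrite basesU1 // -indepU1.
Qed.

End Rank.

(** * Matroids from bases *)

Section OfBases.
Variables (U : finType) (F : {set {set U}}) (r : nat).
Hypothesis F_ex : exists B, B \in F.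
Hypothesis F_card : forall B, B \in F -> #|B| = r.
Hypothesis F_exch : forall B1 B2 x, B1 \in F -> B2 \in F -> x \in B1 :\: B2 ->
  exists2 y, y \in B2 :\: B1 & y |: (B1 :\ x) \in F.

Let ind : {set {set U}} := [set I : {set U} | [exists B in F, I \subset B]].

Let indP (I : {set U}) : reflect (exists2 B, B \in F & I \subset B) (I \in ind).
Proof. by rewrite inE; apply: exists_inP. Qed.

(** Exchange either produces the element or moves [B2] into J + B1. Once also [B1] lies in I + B2,
    the equality of #|B1 - B2| and #|B2 - B1| forces #|J| <= #|I|. *)
Lemma bases_augment (B1 B2 I J : {set U}) : B1 \in F -> B2 \in F ->
  I \subset B1 -> J \subset B2 -> (#|I| < #|J|)%N ->
  exists2 x, x \in J :\: I & exists2 B, B \in F & x |: I \subset B.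
Proof.
have [n] := ubnP #|B2 :\: (J :|: B1)|.
elim: n B2 => // n IH B2 /ltnSE le_n hB1 hB2 IB1 JB2 ltIJ.
have [JB1|[x]] := set_0Vmem ((J :&: B1) :\: I); last first.
  rewrite !inE => /and3P[xI xJ xB1]; exists x; first by rewrite inE xI.
  by exists B1; rewrite // subUset sub1set xB1.
have [B2J|[x]] := set_0Vmem (B2 :\: (J :|: B1)); last first.
  rewrite !inE negb_or => /andP[/andP[xJ xB1] xB2].
  have [|y] := F_exch hB2 hB1 (x := x); first by rewrite inE xB1.
  rewrite inE => /andP[yB2 yB1] hB.
  apply: (IH _ _ hB1 hB) => //.
    apply: leq_trans le_n; apply: proper_card; apply/properP; split.
      apply/subsetP => z; rewrite !inE negb_or => /andP[/andP[-> zB1]].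
      by rewrite zB1; case: eqP zB1 => [->|_ _ /andP[]//]; rewrite yB1.
    by exists x; rewrite !inE ?eqxx ?negb_or ?xJ ?xB1 //= orbF; apply: contraNneq xB1 => ->.
  apply/subsetP => z zJ; rewrite !inE (subsetP JB2 z zJ) andbT orbC.
  by case: eqP zJ => // ->; rewrite (negPf xJ).
have [B1I|[x]] := set_0Vmem (B1 :\: (I :|: B2)); last first.
  rewrite !inE negb_or => /andP[/andP[xI xB2] xB1].
  have [|y] := F_exch hB1 hB2 (x := x); first by rewrite inE xB2.
  rewrite inE => /andP[yB1 yB2] hB; exists y.
    rewrite inE (contra (subsetP IB1 y) yB1) /=.
    have := in_set0 y; rewrite -B2J !inE negb_or yB1 yB2 !andbT.
    by move/negbFE.
  exists (y |: B1 :\ x) => //; apply: setUS; apply/subsetP => z zI.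
  by rewrite !inE (subsetP IB1 z zI) andbT; apply: contraNneq xI => <-.
have s1 : J :\: I \subset B2 :\: B1.
  apply/subsetP => z; rewrite !inE => /andP[zI zJ]; rewrite (subsetP JB2) // andbT.
  by have := in_set0 z; rewrite -JB1 !inE zI zJ /= => ->.
have s2 : B1 :\: B2 \subset I :\: J.
  apply/subsetP => z; rewrite !inE => /andP[zB2 zB1].
  rewrite (contra (subsetP JB2 z) zB2) /=.
  have := in_set0 z; rewrite -B1I !inE negb_or zB1 zB2 !andbT.
  by move/negbFE.
have := subset_leq_card s1; have := subset_leq_card s2.
have := cardsID B1 B2; have := cardsID B2 B1.
rewrite (F_card hB1) (F_card hB2) (setIC B2 B1).
have := cardsID I J; have := cardsID J I; rewrite (setIC J I); lia.
Qed.

(** The ground set is the whole type: [noncrossing] sees only rank and bases, and elements in no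
    basis become loops. *)
Lemma bases_axiom : matroid_axiom setT ind.
Proof.
apply/and4P; split.
- by case: F_ex => B hB; apply/indP; exists B; rewrite ?sub0set.
- by apply/forall_inP => I _; apply: subsetT.
- apply/forall_inP => I /indP[B hB IB]; apply/forallP => J; apply/implyP => JI.
  by apply/indP; exists B => //; apply: subset_trans IB.
apply/forall_inP => I /indP[B1 hB1 IB1]; apply/forall_inP => J /indP[B2 hB2 JB2].
apply/implyP => ltIJ; apply/exists_inP.
have [x xJI hx] := bases_augment hB1 hB2 IB1 JB2 ltIJ.
by exists x => //; apply/indP.
Qed.

Lemma matroid_of_bases : exists M : matroid U, rank M = r /\ bases M = F.
Proof.
exists (Matroid bases_axiom).
have eF B : (B \in ind) && (#|B| == r) = (B \in F).
  apply/andP/idP => [[/indP[B' hB' BB'] /eqP eB]|hB].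
    suff -> : B = B' by [].
    by apply/eqP; rewrite eqEcard BB' eB F_card /=.
  by split; [apply/indP; exists B | rewrite F_card].
have er : rank (Matroid bases_axiom) = r.
  apply/eqP; rewrite eqn_leq; apply/andP; split.
    apply/bigmax_leqP => I /indP[B hB IB].
    by rewrite -(F_card hB) subset_leq_card.
  case: F_ex => B hB; rewrite -(F_card hB) -[in X in (_ <= X)%N]rk_setT.
  by apply: leq_rk; [apply/indP; exists B | apply: subsetT].
by split=> //; apply/setP => B; rewrite inE er; apply: eF.
Qed.

End OfBases.

(** * Noncrossing matroids *)

(** Strict cyclic order, so that the starting point of the linear order can be changed freely. *)
Definition btw (i j k : nat) : bool :=
  [|| i < j < k, j < k < i | k < i < j].

Lemma btw_split u v x y : y != u -> y != v -> y != x ->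
  ~~ btw u y v -> btw u x v -> btw x v y && btw x y u.
Proof. rewrite /btw; lia. Qed.

Section Cyclic.
Variables (U : finType) (pos : U -> nat).
Hypothesis pos_inj : injective pos.
Implicit Types (M : matroid U) (A B E I J S X Y Z : {set U}) (a b c d x y z u v : U).

Definition cyc4 a b c d : bool :=
  btw (pos a) (pos b) (pos c) && btw (pos a) (pos c) (pos d).

(* Basis form of: no circuit through a, c is disjoint from a cocircuit through
   b, d when these pairs cross. *)
Definition noncrossing M : Prop :=
  forall S a b c d, #|S|.+2 = rank M -> cyc4 a b c d ->
    a |: (b |: S) \in bases M -> c |: (d |: S) \in bases M ->
    a |: (c |: S) \in bases M.

Definition carc u v : {set U} := [set x | btw (pos u) (pos x) (pos v)].

Lemma pos_neq x y : x != y -> (pos x != pos y).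
Proof. by apply: contra_neq => /pos_inj. Qed.

Section Arc.
Variable M : matroid U.
Hypothesis ncM : noncrossing M.

(* A hyperplane missing u and v is the direct sum of its traces on the two
   arcs cut by u and v. *)
Lemma arc_closure I u v x : I \in indep M -> #|I|.+1 = rank M ->
  u \notin cl M I -> v \notin cl M I -> x \in cl M I -> x \in carc u v ->
  x \in cl M (I :&: carc u v).
Proof.
move=> hI eI ucl vcl xcl xuv.
have [xI|xI] := boolP (x \in I); first by rewrite mem_cl // inE xI.
(* The elements of [I] outside the arc are discarded one at a time; [cl_indepI] merges the
   results. *)
suff h Y : Y \subset I :\: carc u v -> x \in cl M (I :\: Y).
  by have := h _ (subxx _); rewrite setDDr setDv set0U.
have [n] := ubnP #|Y|; elim: n Y => // n IH Y /ltnSE le_n YI.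
have [->|[y yY]] := set_0Vmem Y; first by rewrite setD0.
have Yy : x \in cl M (I :\: (Y :\ y)).
  by apply: IH; [rewrite (cardsD1 y) yY in le_n | apply: subset_trans YI; apply: subsetDl].
have [yI yuv] := setDP (subsetP YI y yY).
suff xy : x \in cl M (I :\ y).
  have := cl_indepI hI (subsetDl _ _) (subsetDl _ _) xy Yy.
  by rewrite -setDUr setD1K.
apply: contraT => xy.
have yu : y != u by apply: contraNneq ucl => <-; apply: mem_cl.
have yv : y != v by apply: contraNneq vcl => <-; apply: mem_cl.
have yx : y != x by apply: contraNneq xI => <-.
have hIy : I :\ y \in indep M by apply: indepS hI; apply: subsetDl.
have eIy : #|I :\ y|.+1 = #|I| by rewrite [RHS](cardsD1 y) yI.
have xIy : x \notin I :\ y by rewrite inE (negPf xI) andbF.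
have hS : x |: (I :\ y) \in indep M by rewrite indepU1.
have eS : #|x |: (I :\ y)|.+1 = rank M by rewrite cardsU1 xIy add1n eIy.
have clS : cl M (x |: (I :\ y)) \subset cl M I.
  by apply: cl_sub; rewrite subUset sub1set xcl (subset_trans (subsetDl _ _) (sub_cl _ _)).
(* If [I] without [y] did not span [x], this crossing would make x + I a basis, although [I] spans
   [x]. *)
have := @ncM (I :\ y) x v y u; rewrite setD1K // eIy eI.
have : x |: I \notin bases M by rewrite basesU1 // xcl.
move=> /negPf -> h; apply: h => //.
- move: yuv xuv; rewrite !inE /cyc4.
  exact: btw_split (pos_neq yu) (pos_neq yv) (pos_neq yx).
- by rewrite setUCA basesU1 //; apply: contra vcl; apply: (subsetP clS).
- by rewrite setUCA setD1K // basesU1.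
Qed.

Lemma arc_closure_sub I u v Z : I \in indep M -> #|I|.+1 = rank M ->
  u \notin cl M I -> v \notin cl M I -> Z \subset cl M I -> Z \subset carc u v ->
  Z \subset cl M (I :&: carc u v).
Proof.
move=> hI eI ucl vcl /subsetP Zcl /subsetP Zuv; apply/subsetP => x xZ.
by apply: arc_closure; auto.
Qed.

End Arc.
End Cyclic.

Lemma subset_setC1 (T : finType) (A : {set T}) x :
  (A \subset [set~ x]) = (x \notin A).
Proof. by rewrite -disjoints_subset disjoint_sym disjoints1. Qed.

Lemma cardsU1I (T : finType) (A W : {set T}) x : x \notin A ->
  #|(x |: A) :&: W| = (x \in W) + #|A :&: W|.
Proof.
move=> xA; rewrite setIUl; have [xW|xW] := boolP (x \in W).
  rewrite (setIidPl _) ?sub1set // cardsU1.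
  by rewrite in_setI (negPf xA).
by rewrite disjoint_setI0 ?disjoints1 // set0U.
Qed.

(** * Loops and coloops *)

Section Trivial.
Variables (U : finType) (M : matroid U).
Implicit Types (B I X Q : {set U}) (x q : U).

Lemma cl_bases x B : B \in bases M -> x \in cl M B.
Proof.
case/basesP => hB eB; rewrite in_cl eqn_leq (rkS _ (subsetUr _ _)) andbT.
by rewrite (rk_cards hB) eB rk_le_rank.
Qed.

(* Neither a loop nor a coloop. *)
Definition nontrivial x : bool := (x \notin cl M set0) && (x \in cl M [set~ x]).

Lemma trivialP x B : ~~ nontrivial x -> B \in bases M ->
  (x \in B) = (x \notin cl M set0).
Proof.
move=> + hB; rewrite /nontrivial; have [xl _|xl /= xc] := boolP (x \in cl M set0).
  apply/negP => xB; have [hI _] := basesD1 hB xB.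
  by rewrite (mem_clS (sub0set _) xl).
apply: contraT => xB; case/negP: xc; apply: mem_clS (cl_bases x hB).
by rewrite subset_setC1.
Qed.

(** A loop adds nothing to a span. If a coloop helped to span [x], exchange would put it in the
    closure of its complement. *)
Lemma cl_nontrivial x X Q : x \notin Q -> (forall q, q \in Q -> ~~ nontrivial q) ->
  x \in cl M (Q :|: X) -> x \in cl M X.
Proof.
have [n] := ubnP #|Q|; elim: n Q X => // n IH Q X /ltnSE le_n xQ triv.
have [->|[q qQ]] := set_0Vmem Q; first by rewrite set0U.
rewrite -(setD1K qQ) -setUA setUCA => h.
have {}h : x \in cl M (q |: X).
  apply: (IH (Q :\ q)) => //.
  - by rewrite (cardsD1 q) qQ in le_n.
  - by rewrite inE (negPf xQ) andbF.
  - by move=> y /setD1P[_ yQ]; apply: triv.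
have xq : x != q by apply: contraNneq xQ => ->.
have [qX|qX] := boolP (q \in X); first by move: h; rewrite (setUidPr _) ?sub1set.
have := triv _ qQ; rewrite negb_and negbK => /orP[ql|qc].
  apply: mem_cl_trans h _; rewrite subUset sub1set sub_cl andbT.
  exact: mem_clS (sub0set _) ql.
apply: contraT => xX; case/negP: qc.
apply: mem_clS (cl_exchange h xX); rewrite subset_setC1 !inE negb_or qX andbT.
by rewrite eq_sym.
Qed.

End Trivial.

(** * Removing a bridge *)

Section Step.
Variables (U : finType) (p : U -> nat) (M : matroid U) (e f : U) (l : nat).
Hypothesis p_inj : injective p.
Hypothesis ncM : noncrossing p M.
Hypotheses (pe : p e = 0) (f_gt0 : 0 < p f) (f_le : p f <= l).
Hypotheses (e_nt : nontrivial M e) (f_nt : nontrivial M f).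
Hypothesis gap : forall x, 0 < p x < p f -> ~~ nontrivial M x.
(** The hypotheses describe a shortest spanning interval seen from [e]: minimality gives [e_min]
    and, applied at [f], also [f_notin_clZ]. The gap [Q] holds only loops and coloops. *)
Let Z : {set U} := [set x | p f < p x <= l].
Let Q : {set U} := [set x | 0 < p x < p f].
Hypothesis f_notin_clZ : f \notin cl M Z.
Hypothesis e_in_cl : e \in cl M (f |: Z).
Hypothesis e_min : forall k, k < l -> e \notin cl M [set x | 0 < p x <= k].
Implicit Types (B G I J S X : {set U}) (x y z u v : U).

Lemma p_gt0 x : x != e -> 0 < p x.
Proof. by move=> xe; rewrite lt0n -pe; apply: pos_neq. Qed.

Lemma f_neq_e : f != e.
Proof. by apply: contraTneq f_gt0 => ->; rewrite pe. Qed.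

(** A gap element is a loop, hence in every closure, or a coloop, hence in B minus f. *)
Lemma gap_notin_cl B x : B \in bases M -> f \in B -> x != e -> x != f ->
  x \notin cl M (B :\ f) -> p f < p x.
Proof.
move=> hB fB xe xf xcl; rewrite ltnNge; apply/negP => le_x.
have lt_x : p x < p f by rewrite ltn_neqAle le_x andbT; apply: pos_neq.
have tx : ~~ nontrivial M x by apply: gap; rewrite p_gt0.
have xl : x \notin cl M set0 by apply: contra xcl; apply: mem_clS; apply: sub0set.
by case/negP: xcl; apply: mem_cl; rewrite !inE xf (trivialP tx hB).
Qed.

(** Otherwise some hyperplane contains [e] and [Z] but misses [f] and an element [h] beyond [l]. The
    arcs from f to h and from h to f would both span [e]; being disjoint, they would make it a
    loop. *)
Lemma e_notin_clZ : e \notin cl M Z.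
Proof.
apply/negP => eZ.
have [I0 [hI0 _ I0Z eI0]] := rk_indep (indep0 M) (sub0set Z).
have ZI0 : Z \subset cl M I0 by apply: span_rk; rewrite // (rk_cards hI0) eI0.
have fI0 : f \notin cl M I0 by apply: contra f_notin_clZ; apply: mem_clS.
have fnI0 : f \notin I0 by apply: contra fI0; apply: mem_cl.
have [B hB] : exists2 B, B \in bases M & f |: I0 \subset B.
  by apply: bases_ext; rewrite indepU1.
rewrite subUset sub1set => /andP[fB I0B].
have [hI eI fI] := basesD1 hB fB.
have I0I : I0 \subset B :\ f by rewrite subsetD1 I0B.
have eI' : e \in cl M (B :\ f) by apply: mem_cl_trans eZ (subset_trans ZI0 (clS _ I0I)).
(* Since [f] is not a coloop, something else escapes the hyperplane as well. *)
have [h hf hI'] : exists2 h, h != f & h \notin cl M (B :\ f).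
  apply/exists_inP; apply: contraNT fI; rewrite negb_exists_in => /forall_inP nh.
  case/andP: f_nt => _ fc; apply: mem_cl_trans fc _; apply/subsetP => x.
  by rewrite !inE => /nh; rewrite negbK inE.
have he : h != e by apply: contraNneq hI' => ->.
have ph := gap_notin_cl hB fB he hf hI'.
have hl : l < p h.
  rewrite ltnNge; apply: contra hI' => le_h; apply: (subsetP (subset_trans ZI0 (clS _ I0I))).
  by rewrite inE ph.
have e1 : e \in cl M ((B :\ f) :&: carc p h f).
  by apply: arc_closure => //; rewrite inE /btw pe f_gt0 ph.
have e2 : e \in cl M ((B :\ f) :&: carc p f h).
  apply: mem_clS (mem_cl_trans eZ ZI0); rewrite subsetI I0I.
  apply/subsetP => z /(subsetP I0Z); rewrite !inE /btw => /andP[-> zl] /=.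
  by rewrite (leq_ltn_trans zl hl).
have := cl_indepI hI (subsetIl _ _) (subsetIl _ _) e1 e2.
rewrite (_ : _ :&: _ = set0); first by case/andP: e_nt => /negPf ->.
apply/setP => x; rewrite !inE /btw; apply/negP => /andP[/andP[_ h1] /andP[_ h2]].
by move: h1 h2 {e1 e2 ZI0 I0I I0B eI I0Z eI0}; clear; lia.
Qed.

Lemma f_in_cl : f \in cl M (e |: Z).
Proof. exact: cl_exchange e_in_cl e_notin_clZ. Qed.

(** In a basis without [f], the element [e] may thus be replaced by [f]. If the hyperplane contained
    [f], it would miss some [z] of [Z], as [e] is not in it; then the arc from e to z spans [f], and
    up to trivial elements its part in [I] lies in [Z]. *)
Lemma bridge_cl I : I \in indep M -> #|I|.+1 = rank M -> f \notin I ->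
  e \notin cl M I -> f \notin cl M I.
Proof.
move=> hI eI fI ecl; apply/negP => fcl.
have /subsetPn[z zZ zcl] : ~~ (Z \subset cl M I).
  apply: contra ecl => ZI; apply: mem_cl_trans e_in_cl _.
  by rewrite subUset sub1set fcl.
have [/andP[fz zl] ze] : (p f < p z <= l) /\ z != e.
  by move: zZ; rewrite inE => h; split=> //; apply: contraTneq h => ->; rewrite pe.
case/negP: f_notin_clZ.
apply: (@cl_nontrivial _ _ _ _ Q).
- by rewrite inE ltnn andbF.
- by move=> q; rewrite inE; apply: gap.
apply: (mem_clS (X := I :&: carc p e z)); last first.
  by apply: arc_closure => //; rewrite inE /btw pe f_gt0 fz.
apply/subsetP => x; rewrite !inE /btw pe => /andP[xI].
have /(pos_neq p_inj) : x != f by apply: contraNneq fI => <-.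
by move: fz zl; clear; lia.
Qed.

(* Sliding f along the line through e and f into the span of Z destroys exactly
   these bases. *)
Definition bad B : bool := [&& f \in B, e \notin B & Z \subset cl M (B :\ f)].
Definition good : {set {set U}} := [set B in bases M | ~~ bad B].

Lemma goodP B : reflect (B \in bases M /\ ~~ bad B) (B \in good).
Proof. exact: setIdP. Qed.

(** The case of [good_exch] in which [G] spans [e]. Arc closure puts [e] in the span of f + G1 + G2,
    minimality keeps it out of the span of f + G2, and [Z] and [G1] are skew. Submodularity for e +
    f + Z and e + f + G1 + G2 then fails by one. *)
Lemma good_exch_collinear G x z0 :
  e \notin G -> f \in G -> G \in indep M -> #|G|.+1 = rank M ->
  e \in cl M G -> x \notin cl M G -> p f < p x -> z0 \in Z -> z0 \notin cl M G ->
  z0 |: (G :\ f) \in indep M -> Z \subset cl M (z0 |: (G :\ f)) ->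
  f \notin cl M (z0 |: (G :\ f)) -> x \notin cl M (z0 |: (G :\ f)) -> False.
Proof.
move=> eG' fG hG eG eclG xclG fx z0Z z0G hI1 ZI1 fI1 xI1.
set I1 := z0 |: (G :\ f) in hI1 ZI1 fI1 xI1 *; set G0 := G :\ f.
have lx : l < p x.
  by rewrite ltnNge; apply: contra xI1 => le_x; apply: (subsetP ZI1); rewrite inE fx.
have [fz zl] : p f < p z0 /\ p z0 <= l by apply/andP; move: z0Z; rewrite inE.
have eI1 : #|I1|.+1 = rank M.
  have z0G0 : z0 \notin G0 by apply: contra z0G => /setD1P[_ /mem_cl->].
  by rewrite cardsU1 z0G0 -eG [in RHS](cardsD1 f) fG.
pose G1 := G0 :&: [set y | p x < p y]; pose G2 := G0 :&: [set y | p f < p y < p z0].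
have eG12 : e \in cl M (f |: (G1 :|: G2)).
  apply: (@cl_nontrivial _ _ _ _ Q).
  - by rewrite inE pe.
  - by move=> q; rewrite inE; apply: gap.
  have ex : e \in carc p x z0.
    by rewrite inE /btw pe (leq_trans _ fz) // (leq_ltn_trans zl lx).
  apply: mem_clS (arc_closure p_inj ncM hG eG xclG z0G eclG ex).
  apply/subsetP => y; rewrite !inE /btw => /andP[yG].
  have [_|yf] := eqVneq y f; first by rewrite orbT.
  have y_gt0 : 0 < p y by apply: p_gt0; apply: contraNneq eG' => <-.
  have := pos_neq p_inj yf; rewrite yG /=.
  clear -y_gt0 lx fz zl pe; lia.
have G2cl : e \notin cl M (f |: G2).
  (* The set f + G2 lies strictly before [z0], hence in an interval too short to span [e]. *)
  have k_lt : (p z0).-1 < l by clear -fz zl; lia.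
  apply: contra (e_min k_lt); apply: mem_clS; apply/subsetP => y.
  rewrite !inE => /orP[/eqP->|/andP[_]]; clear -f_gt0 fz; lia.
have ZI1' : Z \subset cl M (I1 :&: carc p f x).
  apply: (arc_closure_sub p_inj ncM) => //; apply/subsetP => y.
  by rewrite !inE /btw => /andP[-> yl] /=; rewrite (leq_ltn_trans yl lx).
have G1I1 : G1 \subset I1.
  by apply: subset_trans (subsetIl _ _) (subsetUr _ _).
have hG1 : G1 \in indep M := indepS G1I1 hI1.
(* Inside the independent set [I1], the part between f and x spans [Z] and is disjoint from [G1]. *)
have rkZG1 : rk M Z + #|G1| <= rk M (Z :|: G1).
  have hI1' : I1 :&: carc p f x \in indep M by apply: indepS hI1; apply: subsetIl.
  have := rk_submod M (I1 :&: carc p f x :|: Z) (Z :|: G1).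
  rewrite (rk_span ZI1') (rk_cards hI1') => sm.
  have hU : (I1 :&: carc p f x) :|: G1 \in indep M.
    by apply: indepS hI1; rewrite subUset subsetIl.
  have eU : #|(I1 :&: carc p f x) :|: G1| = #|I1 :&: carc p f x| + #|G1|.
    suff dj : (I1 :&: carc p f x) :&: G1 = set0 by rewrite cardsU dj cards0 subn0.
    apply/setP => y; rewrite !inE /btw; apply/negP.
    move=> /andP[/andP[_ y1] /andP[_ y2]]; move: y1 y2; clear -f_gt0 lx f_le; lia.
  have s1 : (I1 :&: carc p f x) :|: G1 \subset I1 :&: carc p f x :|: Z :|: (Z :|: G1).
    by rewrite -!setUA setUS // !setUA subsetUr.
  have s2 : Z \subset (I1 :&: carc p f x :|: Z) :&: (Z :|: G1).
    by rewrite subsetI subsetUr subsetUl.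
  have := rkS M s1; have := rkS M s2; rewrite (rk_cards hU) eU.
  clear -sm; lia.
have rkfZG1 : rk M (f |: (Z :|: G1)) = (rk M (Z :|: G1)).+1.
  apply/eqP; rewrite -notin_clE; apply: contra fI1 => h.
  by apply: mem_cl_trans h _; rewrite subUset ZI1 (subset_trans G1I1) // sub_cl.
have hfG2 : f |: G2 \in indep M.
  apply: indepS hG; rewrite subUset sub1set fG.
  by apply: subset_trans (subsetIl _ _) (subsetDl _ _).
have efG2 : #|f |: G2| = #|G2|.+1 by rewrite cardsU1 !inE eqxx.
have rk1 : rk M (e |: (f |: Z)) <= (rk M Z).+1.
  by move: e_in_cl; rewrite in_cl => /eqP ->; apply: rkU1.
have rk2 : rk M (e |: (f |: (G1 :|: G2))) <= #|G1| + #|G2|.+1.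
  move: eG12; rewrite in_cl => /eqP ->; apply: leq_trans (rk_le_card _ _) _.
  have [+ _] := leq_card_setU [set f] (G1 :|: G2); have [+ _] := leq_card_setU G1 G2.
  by rewrite cards1; clear; lia.
have rk3 : rk M (e |: (f |: G2)) = #|G2|.+2.
  by move: G2cl; rewrite notin_clE (rk_cards hfG2) efG2 => /eqP.
have G2Z : G2 \subset Z.
  by apply/subsetP => y; rewrite !inE => /and3P[_ -> yz]; clear -yz zl; lia.
have s1 : f |: (Z :|: G1) \subset (e |: (f |: Z)) :|: (e |: (f |: (G1 :|: G2))).
  apply/subsetP => y; rewrite !in_setU => /or3P[|->|->]; rewrite ?orbT //.
  by move=> ->; rewrite orbT.
have s2 : e |: (f |: G2) \subset (e |: (f |: Z)) :&: (e |: (f |: (G1 :|: G2))).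
  by rewrite subsetI !setUS // subsetUr.
have := rk_submod M (e |: (f |: Z)) (e |: (f |: (G1 :|: G2))).
have := rkS M s1; have := rkS M s2; rewrite rk3 rkfZG1.
clear -rkZG1 rk1 rk2; lia.
Qed.

(** If no exchange were good, each [y] of [B2] not spanned by [G] would make y + G bad. Outside the
    collinear case this confines B2 minus f to a hyperplane spanned together with [Z], so [B2] would
    be bad itself. *)
Lemma good_exch B1 B2 x : B1 \in good -> B2 \in good -> x \in B1 :\: B2 ->
  exists2 y, y \in B2 :\: B1 & y |: (B1 :\ x) \in good.
Proof.
move=> /goodP[hB1 gB1] /goodP[hB2 gB2] xB12; have [xB1 xB2] := setDP xB12.
have [hG eG xG] := basesD1 hB1 xB1; set G := B1 :\ x in hG eG xG *.
apply/exists_inP; apply: contraT; rewrite negb_exists_in => /forall_inP none.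
have xnG : x \notin G by rewrite !inE eqxx.
have eB1 : B1 = x |: G by rewrite setD1K.
have cand y : y \in B2 -> y \notin cl M G -> bad (y |: G).
  move=> yB2 yG; have := none y; rewrite [_ \in good]in_set basesU1 // yG /= negbK; apply.
  have ynG : y \notin G by apply: contra yG; apply: mem_cl.
  rewrite inE yB2 andbT eB1 in_setU1 negb_or ynG andbT.
  by apply: contraNneq xB2 => <-.
have [y0 /setDP[y0B2 _]] := bases_exchange hB1 hB2 xB12.
rewrite basesU1 // => y0G.
have /and3P[fy0 ey0 Zy0] := cand _ y0B2 y0G.
have eG' : e \notin G by apply: contra ey0 => eG'; rewrite in_setU1 eG' orbT.
(* Without [f] in [G] the only candidate is [f], so B2 minus f spans the same hyperplane as [G]. *)
have [fG|fG] := boolP (f \in G); last first.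
  have ey : y0 = f by move: fy0; rewrite in_setU1 (negPf fG) orbF => /eqP.
  rewrite {}ey in y0B2 y0G fy0 ey0 Zy0; rewrite setU1K // in Zy0.
  have B2G : B2 :\ f \subset cl M G.
    apply/subsetP => y /setD1P[yf yB2]; apply: contraNT yf => yG.
    have /and3P[fy _ _] := cand _ yB2 yG.
    by move: fy; rewrite in_setU1 (negPf fG) orbF eq_sym.
  have [hI eI fI] := basesD1 hB2 y0B2.
  have GI : cl M G \subset cl M (B2 :\ f).
    by apply: cl_basis_eq => //; rewrite -ltnS eG eI.
  case/negP: gB2; rewrite /bad y0B2 (subset_trans Zy0 GI) andbT /=.
  apply: contra y0G => eB2.
  apply: mem_cl_trans f_in_cl _; rewrite subUset sub1set Zy0 andbT.
  by apply: (subsetP B2G); rewrite !inE eB2 eq_sym f_neq_e.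
have setDf y (A : {set U}) : y != f -> (y |: A) :\ f = y |: (A :\ f).
  by move=> yf; apply/setP => w; rewrite !inE; case: (eqVneq w y) => [->|]; rewrite ?yf.
have eGf : G = f |: (G :\ f) by rewrite setD1K.
set G0 := G :\ f in eGf *.
have fnG0 : f \notin G0 by rewrite !inE eqxx.
have hG0 : G0 \in indep M by apply: indepS hG; apply: subsetDl.
have fG0 : f \notin cl M G0 by apply: indep_notin_cl; rewrite -?eGf.
have clG0G : cl M G0 \subset cl M G by apply: clS; apply: subsetDl.
have eG0 : #|G0|.+2 = rank M by rewrite -eG [in RHS](cardsD1 f) fG.
have notG_neqf y : y \notin cl M G -> y != f.
  by apply: contraNneq => ->; apply: mem_cl.
have y0f := notG_neqf _ y0G; have xf := notG_neqf _ xG.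
rewrite setDf // -/G0 in Zy0.
have B1f : B1 :\ f = x |: G0 by rewrite eB1 setDf.
have notbadB1 : x != e -> ~~ (Z \subset cl M (x |: G0)).
  move=> xe; apply: contra gB1 => Zx; rewrite /bad B1f Zx andbT.
  by rewrite eB1 !in_setU1 fG orbT negb_or eG' andbT eq_sym.
have fy : f \notin cl M (y0 |: G0).
  by apply: contra y0G => /cl_exchange-/(_ fG0); rewrite -eGf.
have spanf X : e \in cl M X -> Z \subset cl M X -> f \in cl M X.
  by move=> eX ZX; apply: mem_cl_trans f_in_cl _; rewrite subUset sub1set eX.
have ey : e \notin cl M (y0 |: G0) by apply: contra fy => /spanf; apply.
(* The hyperplane spanned by z0 + G0 does not depend on the candidate: every [y] of [B2] outside the
   closure of [G] lies in it. *)
have /subsetPn[z0 z0Z z0G0] : ~~ (Z \subset cl M G0).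
  apply/negP => ZG0; have [xe|/notbadB1] := eqVneq x e; last first.
    by rewrite (subset_trans ZG0) // clS // subsetUr.
  case/negP: xG; rewrite xe; apply: mem_cl_trans e_in_cl _.
  by rewrite subUset sub1set (subset_trans ZG0) // mem_cl.
have z0y : z0 \in cl M (y0 |: G0) by apply: (subsetP Zy0).
have y0z : y0 \in cl M (z0 |: G0) by apply: cl_exchange z0y z0G0.
have sub_yz : cl M (y0 |: G0) \subset cl M (z0 |: G0).
  by apply: cl_sub; rewrite subUset sub1set y0z (subset_trans (subsetUr _ _) (sub_cl _ _)).
have sub_zy : cl M (z0 |: G0) \subset cl M (y0 |: G0).
  by apply: cl_sub; rewrite subUset sub1set z0y (subset_trans (subsetUr _ _) (sub_cl _ _)).
have xy : x \notin cl M (y0 |: G0).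
  apply/negP => xy; have xe : x != e by apply: contraNneq ey => <-.
  case/negP: (notbadB1 xe); apply: subset_trans Zy0 _; apply: cl_sub.
  rewrite subUset sub1set (subset_trans (subsetUr _ _) (sub_cl _ _)) andbT.
  by apply: cl_exchange xy (contra (subsetP clG0G x) xG).
have z0G : z0 \notin cl M G.
  apply: contra fy; rewrite {1}eGf => /cl_exchange-/(_ z0G0).
  exact: (subsetP sub_zy).
have span12 y : y \in B2 -> y \notin cl M G -> y \in cl M (z0 |: G0).
  move=> yB2 yG; have /and3P[_ _] := cand _ yB2 yG.
  rewrite setDf ?notG_neqf // => /subsetP/(_ _ z0Z) h.
  exact: cl_exchange h z0G0.
have hI1 : z0 |: G0 \in indep M.
  by rewrite indepU1 //; apply: contra z0G0; apply: mem_cl.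
have eI1 : #|z0 |: G0|.+1 = rank M.
  by rewrite cardsU1 (contra _ z0G0) ?add1n //; apply: mem_cl.
have ZI1 : Z \subset cl M (z0 |: G0) by apply: subset_trans Zy0 sub_yz.
have fI1 := contra (subsetP sub_zy f) fy.
have eI1' := contra (subsetP sub_zy e) ey.
have [eclG|eclG] := boolP (e \in cl M G).
  exfalso; apply: (@good_exch_collinear G x z0) => //.
    have xe : x != e by apply: contraNneq xG => ->.
    rewrite ltnNge; apply/negP => le_x.
    have tx : ~~ nontrivial M x.
      by apply: gap; rewrite p_gt0 // ltn_neqAle le_x andbT; apply: pos_neq.
    by move: xB1; rewrite (trivialP tx hB1) -(trivialP tx hB2) (negPf xB2).
  exact: contra (subsetP sub_zy x) xy.
(* As [e] is not spanned by [G], [bridge_cl] shows that adding [f] to [G0] enlarges the closure by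
   [f] alone. *)
have clG_sub w : w \in cl M G -> w != f -> w \in cl M G0.
  move=> wG wf; apply: contraT => wG0.
  have wnG0 : w \notin G0 by apply: contra wG0; apply: mem_cl.
  have fw : f \in cl M (w |: G0) by apply: cl_exchange wG0; rewrite -eGf.
  have /negP[] : f \notin cl M (w |: G0); last by [].
  apply: bridge_cl; first by rewrite indepU1.
  - by rewrite cardsU1 wnG0 add1n.
  - by rewrite !inE negb_or eq_sym wf eqxx.
  apply: contra eclG; apply: (subsetP (cl_sub _)).
  by rewrite subUset sub1set wG (subset_trans (subsetDl _ _) (sub_cl _ _)).
have B2I1 : B2 :\ f \subset cl M (z0 |: G0).
  apply/subsetP => y /setD1P[yf yB2]; have [yG|yG] := boolP (y \in cl M G).
    by apply: (subsetP (clS _ (subsetUr _ _))); apply: clG_sub.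
  exact: span12.
have fB2 : f \in B2.
  apply: contraT => fB2; case/negP: fI1; apply: mem_cl_trans (cl_bases f hB2) _.
  apply/subsetP => y yB2; apply: (subsetP B2I1).
  by rewrite !inE yB2 andbT; apply: contraNneq fB2 => <-.
have [hI eI fI] := basesD1 hB2 fB2.
case/negP: gB2; rewrite /bad fB2 /=; apply/andP; split.
  apply: contra eI1' => eB2; apply: (subsetP B2I1).
  by rewrite !inE eB2 eq_sym f_neq_e.
apply: subset_trans ZI1 _; apply: cl_basis_eq => //.
by rewrite -ltnS eI1 eI.
Qed.

(** Together with [good_arc] this turns badness into the violation of a cardinality bound on
    intervals starting at [f], which can be followed through a crossing. The interval ends at the
    first element that B minus f does not span. *)
Lemma bad_arc B : B \in bases M -> bad B -> exists2 hi,
  Z \subset [set x | p f < p x < hi] &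
  rk M [set x | p f < p x < hi] < #|B :&: (f |: [set x | p f < p x < hi])|.
Proof.
move=> hB /and3P[fB eB ZB]; have [hI eI fI] := basesD1 hB fB.
set I := B :\ f in hI eI fI ZB *.
have eclI : e \notin cl M I.
  apply: contra fI => eI'; apply: mem_cl_trans f_in_cl _.
  by rewrite subUset sub1set eI'.
pose N := (\max_x p x).+1.
have ltN x : p x < N by rewrite ltnS; apply: leq_bigmax.
pose q x := if x == e then N else p x.
have [v /andP[vI vf] v_min] := @arg_minnP _ e (fun v => (v \notin cl M I) && (v != f)) q
  (introT andP (conj eclI (contra_neq esym f_neq_e))).
have carcE : carc p f v = [set x | p f < p x < q v].
  apply/setP => x; rewrite !inE /btw /q; have [->|ve] := eqVneq v e.
    by rewrite pe ltN /=; clear -f_gt0; lia.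
  have := gap_notin_cl hB fB ve vf vI; clear; lia.
have sub_I : carc p f v \subset cl M I.
  apply/subsetP => x; rewrite carcE inE => /andP[fx xv]; apply: contraLR xv => xI.
  rewrite -leqNgt.
  have xf : x != f by apply: contraTneq fx => ->; rewrite ltnn.
  have := v_min x; rewrite xI xf => /(_ isT); rewrite {2}/q; case: eqP => // xe.
  by rewrite xe pe in fx.
exists (q v); rewrite -carcE.
  apply/subsetP => z zZ; rewrite carcE inE.
  have /andP[fz zl] : p f < p z <= l by move: zZ; rewrite inE.
  rewrite fz /= /q; have [_|ve] := eqVneq v e; first exact: ltN.
  have fv := gap_notin_cl hB fB ve vf vI.
  rewrite ltnNge; apply: contra vI => vz; apply: (subsetP ZB).
  by rewrite inE fv (leq_trans vz zl).
have := rk_spanS (arc_closure_sub p_inj ncM hI eI fI vI sub_I (subxx _)).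
rewrite (rk_cards (indepS (subsetIl _ _) hI)) => le.
rewrite (cardsD1 f) in_setI fB setU11 add1n ltnS; apply: leq_trans le _.
apply: subset_leq_card; apply/subsetP => x; rewrite in_setI => /andP[/setD1P[xf xB] xv].
by rewrite in_setD1 xf in_setI xB in_setU1 xv orbT.
Qed.

(** If [e] is in [B], it is spanned by f + J and uses up the one unit of rank that [f] may add to
    the interval [J]. If not, a violation would make B minus f span [Z]. *)
Lemma good_arc B hi : B \in good -> Z \subset [set x | p f < p x < hi] ->
  #|B :&: (f |: [set x | p f < p x < hi])| <= rk M [set x | p f < p x < hi].
Proof.
set J := [set x | _] => /goodP[hB gB] ZJ.
have fJ : f \notin J by rewrite inE ltnn.
have eJ : e \notin J by rewrite inE pe.
have [fB|fB] := boolP (f \in B); last first.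
  rewrite setIUr disjoint_setI0 ?set0U; last by rewrite disjoint_sym disjoints1.
  by apply: leq_rk (subsetIr _ _); apply: indepS (bases_indep hB); apply: subsetIl.
have [eB|eB] := boolP (e \in B).
  have h1 : B :&: (e |: (f |: J)) \in indep M.
    by apply: indepS (bases_indep hB); apply: subsetIl.
  have := leq_rk h1 (subsetIr _ _).
  have eq1 : rk M (e |: (f |: J)) = rk M (f |: J).
    apply/eqP; rewrite -in_cl; apply: mem_clS e_in_cl; exact: setUS.
  have := rkU1 M f J; rewrite eq1 (cardsD1 e) in_setI eB setU11 add1n => h2 h3.
  have := leq_trans h3 h2; rewrite ltnS; apply: leq_trans.
  apply: subset_leq_card; apply/subsetP => x; rewrite in_setI => /andP[xB xJ].
  rewrite in_setD1 in_setI xB in_setU1 xJ orbT !andbT.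
  apply: contraTneq xJ => ->; rewrite in_setU1 negb_or eJ andbT eq_sym.
  exact: f_neq_e.
rewrite (cardsD1 f) in_setI fB setU11 add1n ltnNge; apply: contra gB => le.
rewrite /bad fB eB /=.
have eBJ : (B :&: (f |: J)) :\ f = (B :\ f) :&: J.
  apply/setP => x; rewrite in_setD1 !in_setI in_setD1 in_setU1.
  by case: (eqVneq x f) => //= _.
rewrite {}eBJ in le.
have hI : (B :\ f) :&: J \in indep M.
  apply: indepS (bases_indep hB); apply: subset_trans (subsetIl _ _) (subsetDl _ _).
apply: subset_trans ZJ _; apply: subset_trans (clS M (subsetIl (B :\ f) J)).
by apply: span_rk; rewrite ?subsetIr // (rk_cards hI).
Qed.

Lemma bad_swap B : B \in bases M -> bad B -> e |: (B :\ f) \in good.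
Proof.
move=> hB /and3P[fB eB ZB]; have [hI eI fI] := basesD1 hB fB.
apply/goodP; split.
  rewrite basesU1 //; apply: contra fI => eI'; apply: mem_cl_trans f_in_cl _.
  by rewrite subUset sub1set eI'.
by rewrite /bad !inE eqxx orbF (negPf f_neq_e).
Qed.

Lemma bad_ex : exists2 B, B \in bases M & bad B.
Proof.
have [I0 [hI0 _ I0Z eI0]] := rk_indep (indep0 M) (sub0set Z).
have ZI0 : Z \subset cl M I0 by apply: span_rk; rewrite // (rk_cards hI0) eI0.
have fI0 : f \notin cl M I0 by apply: contra f_notin_clZ; apply: mem_clS.
have fnI0 : f \notin I0 by apply: contra fI0; apply: mem_cl.
have [B hB] : exists2 B, B \in bases M & f |: I0 \subset B.
  by apply: bases_ext; rewrite indepU1.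
rewrite subUset sub1set => /andP[fB I0B]; exists B => //.
have I0I : I0 \subset B :\ f by rewrite subsetD1 I0B.
rewrite /bad fB (subset_trans ZI0 (clS _ I0I)) andbT /=.
apply/negP => eB; have [_ _ /negP[]] := basesD1 hB eB.
apply: mem_cl_trans e_in_cl _; rewrite subUset sub1set mem_cl; last first.
  by rewrite !inE f_neq_e.
apply: subset_trans ZI0 (clS _ _); rewrite subsetD1 I0B.
by apply: contra (subsetP I0Z e) _; rewrite inE pe.
Qed.

Lemma bridge_step : exists M' : matroid U,
  [/\ rank M' = rank M, noncrossing p M', bases M' \proper bases M &
   forall B, (B \in bases M) = (B \in bases M') ||
     [&& f \in B, e \notin B & e |: (B :\ f) \in bases M'] ].
Proof.
have [B0 hB0 bB0] := bad_ex.
have [|||M' [eM' bM']] := @matroid_of_bases U good (rank M).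
- by exists (e |: (B0 :\ f)); apply: bad_swap.
- by move=> B /goodP[/bases_card].
- exact: good_exch.
exists M'; rewrite eM' bM'; split=> //.
- move=> S a b c d; rewrite eM' bM' => eS cyc hab hcd.
  have [hab' _] := goodP _ hab; have [hcd' _] := goodP _ hcd.
  have hac := ncM eS cyc hab' hcd'.
  (* An interval containing [a] and [c] contains [b] or [d], so it meets {a, c} in at most as many
     points as one of {a, b}, {c, d}. A bound broken by a + c + S is broken by one of the two good
     bases. *)
  apply/goodP; split=> //; apply/negP => /(bad_arc hac)[hi Zhi].
  have := good_arc hab Zhi; have := good_arc hcd Zhi.
  set W := f |: _; set k := rk _ _.
  have cardW x y : #|x |: (y |: S)| = rank M ->
    #|(x |: (y |: S)) :&: W| = (x \in W) + (y \in W) + #|S :&: W|.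
    rewrite !cardsU1 -eS; have [xyS|xyS] := boolP (x \in y |: S).
      by case: (y \in S) => /=; clear; lia.
    have [yS|yS _] := boolP (y \in S); first by clear; lia.
    by rewrite !cardsU1I // addnA.
  rewrite !cardW ?(bases_card hab') ?(bases_card hcd') ?(bases_card hac) //.
  (* The [maxn] covers an empty interval, where [W] is just {f}. *)
  have inW x : x \in W = (p f <= p x < maxn hi (p f).+1).
    rewrite in_setU1 inE; have [->|] := eqVneq x f; first by clear; lia.
    by move/(pos_neq p_inj); clear; lia.
  rewrite !inW; move: cyc; rewrite /cyc4 /btw; clear; lia.
- apply/properP; split; first by apply/subsetP => B /goodP[].
  by exists B0 => //; apply/goodP => -[_]; rewrite bB0.
move=> B; apply/idP/orP => [hB|[/goodP[]//|/and3P[fB eB /goodP[hB _]]]].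
  have [bB|gB] := boolP (bad B); [right|by left; apply/goodP].
  by have /and3P[-> -> _] := bB; rewrite bad_swap.
have eI : e \notin B :\ f by rewrite inE (negPf eB) andbF.
have [] := basesD1 hB (setU11 _ _); rewrite setU1K // => hI cI eclI.
rewrite -(setD1K fB) basesU1 //; apply: bridge_cl => //.
by rewrite !inE eqxx.
Qed.

End Step.

(** * Signed minors *)

(** Adjacent transpositions suffice, as in bubble sort; this reduces reordering of signed minors to
    [dets_swap] and [inversions_swap]. *)
Lemma perm_invariant (T : eqType) (V : Type) (phi : seq T -> V) :
  (forall a x y b, phi (a ++ x :: y :: b) = phi (a ++ y :: x :: b)) ->
  forall s t, perm_eq s t -> phi s = phi t.
Proof.
move=> swap s; elim: s phi swap => [|x s IH] phi swap t st.
  by rewrite perm_sym in st; move/perm_nilP: st => ->.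
have xt : x \in t by rewrite -(perm_mem st) mem_head.
case/splitPr: xt st => a b st.
have {}st : perm_eq s (a ++ b).
  by rewrite -(perm_cons x) (perm_trans st) // -cat1s perm_catCA.
rewrite (IH (fun u => phi (x :: u)) _ _ st); last by move=> *; apply: (swap (x :: _)).
clear st; elim/last_ind: a b => [//|a y {}IH] b.
by rewrite cat_rcons IH cat_rcons swap.
Qed.

Section SignedMinors.
Variables (T : eqType) (pos : T -> nat).
Hypothesis pos_inj : injective pos.
Implicit Types (s t a b : seq T) (x y : T).
Local Open Scope ring_scope.

Fixpoint inversions s : nat :=
  if s is x :: t then (count (fun y => pos y < pos x)%N t + inversions t)%N else 0%N.

Lemma inversions_swap a b x y : x != y ->
  odd (inversions (a ++ x :: y :: b)) = ~~ odd (inversions (a ++ y :: x :: b)).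
Proof.
move=> xy; have pxy : pos x != pos y by apply: contra_neq xy => /pos_inj.
elim: a => [|z a IH] /=; last first.
  by rewrite !oddD IH !count_cat /= (addnCA (pos x < _)%N) addbN.
by move: pxy; clear; lia.
Qed.

Lemma inversions_sorted s : sorted ltn (map pos s) -> inversions s = 0%N.
Proof.
elim: s => //= x s IH sx; rewrite IH ?(path_sorted sx) // addn0.
apply/eqP; rewrite eqn0Ngt -has_count; apply/hasPn => y ys.
have := allP (order_path_min ltn_trans sx) (pos y) (map_f _ ys).
by rewrite -leqNgt => /ltnW.
Qed.

Variables (R : comRingType) (r : nat).
Implicit Types (V W : seq 'rV[R]_r).

Definition dets V : R := \det (\matrix_(i < r) nth 0 V i).

Lemma dets_swap V W (u w : 'rV[R]_r) : ((size V).+1 < r)%N ->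
  dets (V ++ u :: w :: W) = - dets (V ++ w :: u :: W).
Proof.
move=> lt_r; pose i1 := Ordinal (ltnW lt_r); pose i2 := Ordinal lt_r.
have i12 : i1 != i2 by rewrite -val_eqE /= neq_ltn ltnSn.
rewrite /dets -[RHS]mulN1r.
have -> : (-1 : R) = (-1) ^+ (tperm i1 i2) by rewrite odd_tperm i12.
rewrite -det_perm -det_mulmx -row_permE; congr (\det _).
apply/matrixP => i j; rewrite !mxE permE /= !nth_cat.
have [->|ne1] := eqVneq i i1; first by rewrite /= ltnn subnn ltnNge leqnSn subSnn.
have [->|ne2] := eqVneq i i2; first by rewrite /= ltnn subnn ltnNge leqnSn subSnn.
case: ltnP => // le_i; congr ((_ : 'rV_r) 0 j).
move: ne1 ne2; rewrite -!val_eqE /=.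
have -> : (i = (i - size V) + size V :> nat)%N by rewrite subnK.
rewrite addnK; case: (i - size V)%N => [|[|k]] //.
by rewrite add0n eqxx.
by rewrite add1n eqxx.
Qed.

Lemma dets_linear (V : seq 'rV[R]_r) (u w : 'rV[R]_r) k : (0 < r)%N ->
  dets (u + k *: w :: V) = dets (u :: V) + k * dets (w :: V).
Proof.
move=> r_gt0; pose i0 := Ordinal r_gt0.
rewrite -[dets (u :: V)]mul1r; apply: (determinant_multilinear (i0 := i0)).
- by rewrite !rowK /= scale1r.
- by apply/matrixP => i j; rewrite !mxE.
- by apply/matrixP => i j; rewrite !mxE.
Qed.

Lemma dets0 (V : seq 'rV[R]_r) : (0 < r)%N -> dets (0 :: V) = 0.
Proof.
move=> r_gt0; have := dets_linear V 0 0 1 r_gt0.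
by rewrite scale1r addr0 mul1r => /esym/eqP; rewrite -subr_eq0 addrK => /eqP.
Qed.

Lemma dets_alternate V (w : 'rV[R]_r) : ((size V).+1 = r)%N -> w \in V -> dets (w :: V) = 0.
Proof.
move=> eV wV; have lt_i : ((index w V).+1 < r)%N by rewrite -[X in (_ < X)%N]eV ltnS index_mem.
have r_gt0 : (0 < r)%N by rewrite -eV.
apply: (determinant_alternate (i1 := Ordinal r_gt0) (i2 := Ordinal lt_i)) => // j.
by rewrite !mxE /= nth_index.
Qed.

(* The sign makes the minor independent of the order in which s is listed. *)
Definition sminor (v : T -> 'rV[R]_r) s : R :=
  (-1) ^+ inversions s * dets (map v s).

Lemma perm_sminor (v : T -> 'rV[R]_r) s t : uniq s -> size s = r ->
  perm_eq s t -> sminor v s = sminor v t.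
Proof.
move=> us es st.
pose phi s := if uniq s && (size s == r) then sminor v s else 0.
have h : phi s = phi t.
  apply: perm_invariant st => a x y b; rewrite /phi.
  have pab : perm_eq (a ++ x :: y :: b) (a ++ y :: x :: b).
    by rewrite perm_cat2l -(cat1s x) -(cat1s y) perm_catCA.
  rewrite -(perm_uniq pab) -(perm_size pab); case: ifP => // /andP[uab /eqP eab].
  rewrite /sminor !map_cat /= dets_swap; last first.
    by rewrite size_map -eab size_cat /= !addnS !ltnS leq_addr.
  have xy : x != y.
    move: uab; rewrite cat_uniq => /and3P[_ _] /=.
    by rewrite inE negb_or => /andP[/andP[]].
  rewrite -(signr_odd _ (inversions _)) inversions_swap // signrN signr_odd.
  by rewrite mulrNN.
by move: h; rewrite /phi -(perm_uniq st) -(perm_size st) us es eqxx.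
Qed.

Lemma sminor_cons (v : T -> 'rV[R]_r) x s :
  sminor v (x :: s) =
  (-1) ^+ count (fun y => pos y < pos x)%N s * ((-1) ^+ inversions s * dets (v x :: map v s)).
Proof. by rewrite /sminor /= exprD mulrA. Qed.

Lemma sminor0 (v : T -> 'rV[R]_r) x s : uniq s -> size s = r -> x \in s ->
  v x = 0 -> sminor v s = 0.
Proof.
move=> us es xs vx0; rewrite (perm_sminor _ us es (perm_to_rem xs)) sminor_cons vx0.
have r_gt0 : (0 < r)%N by rewrite -es; case: (s) xs.
by rewrite dets0 // !mulr0.
Qed.

End SignedMinors.

(** * Nonnegative minors force the noncrossing property *)

Section PositiveRep.
Variables (R : realFieldType) (U : finType) (pos : U -> nat).
Hypothesis pos_inj : injective pos.
Implicit Types (M : matroid U) (s t : seq U) (a b c d e f x y : U).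
Local Open Scope ring_scope.

(** Lists may come in any order by [perm_sminor]; on an increasing list the sign is 1 and this is
    the ordinary minor. *)
Definition positive_rep r (v : U -> 'rV[R]_r) (F : {set {set U}}) : Prop :=
  forall s, uniq s -> size s = r ->
    0 <= sminor pos v s /\ (sminor pos v s != 0) = ([set x in s] \in F).

Lemma dets_sum r n (V : seq 'rV[R]_r) (k : 'I_n -> R) (w : 'I_n -> 'rV[R]_r) :
  (0 < r)%N ->
  dets ((\sum_i k i *: w i) :: V) = \sum_i k i * dets (w i :: V).
Proof.
move=> r_gt0; elim/big_ind2: _ => [|x1 x2 y1 y2 <- <-|i _]; first exact: dets0.
  by rewrite -{1}(scale1r y2) dets_linear // mul1r.
by rewrite -[k i *: w i]add0r dets_linear // dets0 // add0r.
Qed.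

(* Since c lies in the span of a and t, it acts as a multiple of a in every
   minor containing t. *)
Lemma dets_proportional r (a b c d : 'rV[R]_r) (t : seq 'rV[R]_r) :
  (size t).+2 = r -> dets (a :: b :: t) != 0 -> dets (a :: c :: t) = 0 ->
  dets (a :: b :: t) * dets (c :: d :: t) = dets (a :: d :: t) * dets (c :: b :: t).
Proof.
move=> er abN0 ac0; have r_gt1 : (1 < r)%N by rewrite -er.
have r_gt0 := ltnW r_gt1; pose V := [:: a, b & t].
set A := \matrix_(i < r) nth 0 V i.
have uA : A \in unitmx by rewrite unitmxE unitfE.
pose u := c *m invmx A.
have ec : c = \sum_i u 0 i *: V`_i.
  rewrite -[LHS](mulmxKV uA) -/u mulmx_sum_row; apply: eq_bigr => i _.
  by rewrite rowK.
pose i0 := Ordinal r_gt0; pose i1 := Ordinal r_gt1.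
have dc (y : 'rV[R]_r) : dets (c :: y :: t) =
    u 0 i0 * dets (a :: y :: t) + u 0 i1 * dets (b :: y :: t).
  rewrite ec dets_sum // (bigD1 i0) //= (bigD1 i1) //= big1 ?addr0 // => i /andP[ne0 ne1].
  rewrite dets_alternate ?mulr0 //= ?er // inE.
  move: ne0 ne1; rewrite -!val_eqE /=; case: (i) => -[|[|k]] //= lt_k _ _.
  by rewrite mem_nth ?orbT // -ltnS -ltnS er.
have swap (x y : 'rV[R]_r) : dets (x :: y :: t) = - dets (y :: x :: t).
  by apply: (dets_swap (V := [::])).
have u1 : u 0 i1 = 0.
  have := dc a; rewrite swap ac0 oppr0 dets_alternate ?mem_head //= ?er // mulr0 add0r.
  by move/esym/eqP; rewrite mulf_eq0 swap oppr_eq0 (negPf abN0) orbF => /eqP.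
rewrite !dc u1 !mul0r !addr0; ring.
Qed.

Lemma noncrossing_rep M (v : U -> 'rV[R]_(rank M)) :
  positive_rep v (bases M) -> noncrossing pos M.
Proof.
move=> rep S a b c d eS cyc hab hcd.
have bS x y : x |: (y |: S) \in bases M -> [/\ x != y, x \notin S & y \notin S].
  move=> /bases_card; rewrite !cardsU1 in_setU1 negb_or -eS.
  by case: (x != y) (x \in S) (y \in S) => [] [] [] //=; clear; lia.
have [ab aS bS'] := bS _ _ hab; have [cd cS dS] := bS _ _ hcd.
pose t := enum S.
have et : (size t).+2 = rank M by rewrite -cardE.
have st x y : [set z in [:: x, y & t]] = x |: (y |: S).
  by apply/setP => z; rewrite !inE mem_enum.
pose g x y := sminor pos v [:: x, y & t].
have gP x y : x != y -> x \notin S -> y \notin S ->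
    0 <= g x y /\ (g x y != 0) = (x |: (y |: S) \in bases M).
  move=> xy xS yS; rewrite -st; apply: rep => //.
  by rewrite /= inE negb_or xy !mem_enum xS yS enum_uniq.
pose w x y := dets (v x :: v y :: map v t).
(* Each product in the Pluecker relation contains every [eps] once, so only the pair signs [tau]
   have to be compared. *)
pose eps x : R := (-1) ^+ count (fun z => (pos z < pos x)%N) t.
pose tau x y : R := (-1) ^+ (pos y < pos x)%N.
have gE x y : g x y = tau x y * (eps x * eps y * (-1) ^+ inversions pos t) * w x y.
  rewrite /g /sminor /= !exprD /tau /eps /w; ring.
have dist x y : pos x != pos y -> x != y by apply: contra_neq => ->.
have [ac ad bc] : [/\ a != c, a != d & b != c].
  by move: cyc; rewrite /cyc4 /btw => cyc; split; apply: dist; move: cyc; clear; lia.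
have [gab nab] := gP _ _ ab aS bS'; have [gcd ncd] := gP _ _ cd cS dS.
have [gac nac] := gP _ _ ac aS cS; have [gad nad] := gP _ _ ad aS dS.
have [gbc nbc] := gP _ _ bc bS' cS.
rewrite -nac; apply/negP => /eqP gac0.
have sN0 n : (-1) ^+ n != 0 :> R by rewrite expf_neq0 // oppr_eq0 oner_eq0.
have wac0 : w a c = 0.
  by apply/eqP; move: gac0 => /eqP; rewrite gE !mulf_eq0 /eps /tau !(negPf (sN0 _)).
have wab : w a b != 0.
  by move: nab; rewrite hab gE => h; apply: contraTneq h => ->; rewrite mulr0 eqxx.
have prop : w a b * w c d = w a d * w c b.
  by apply: dets_proportional; rewrite ?size_map.
have wcb : w c b = - w b c by apply: (dets_swap (V := [::])); rewrite -et.
have tauE : tau a b * tau c d = tau a d * tau b c.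
  rewrite /tau -!signr_addb; congr (_ ^+ _).
  by move: cyc; rewrite /cyc4 /btw; clear; lia.
(* The Pluecker relation with its middle term zero: the left side is positive and the right side is
   not. *)
have gg : g a b * g c d = - (g a d * g b c).
  have -> : g a b * g c d = tau a b * tau c d * (eps a * eps b * eps c * eps d *
      ((-1) ^+ inversions pos t) ^+ 2) * (w a b * w c d) by rewrite !gE; ring.
  have -> : g a d * g b c = tau a d * tau b c * (eps a * eps b * eps c * eps d *
      ((-1) ^+ inversions pos t) ^+ 2) * (w a d * w b c) by rewrite !gE; ring.
  rewrite tauE prop wcb; ring.
have gab0 : 0 < g a b by rewrite lt_def nab hab gab.
have gcd0 : 0 < g c d by rewrite lt_def ncd hcd gcd.
have := mulr_gt0 gab0 gcd0; rewrite gg oppr_gt0.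
by rewrite ltNge mulr_ge0.
Qed.

End PositiveRep.

(** * Noncrossing matroids are represented by nonnegative minors *)

Section Rotation.
Variables (U : finType) (pos : U -> nat).
Hypothesis pos_inj : injective pos.
Implicit Types (M : matroid U) (a b c e f x y : U).

(** The circle has length one more than the largest position, and is read from [e] onwards. *)
Definition rot_pos e x : nat :=
  if pos e <= pos x then pos x - pos e else pos x + (\max_y pos y).+1 - pos e.

Let bound x : pos x <= \max_y pos y.
Proof. exact: leq_bigmax. Qed.

Lemma rot_pos_self e : rot_pos e e = 0.
Proof. by rewrite /rot_pos leqnn subnn. Qed.

Lemma rot_pos_inj e : injective (rot_pos e).
Proof.
move=> x y h; apply: pos_inj; move: h (bound x) (bound y) (bound e).
by rewrite /rot_pos; clear; case: ifP; case: ifP; lia.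
Qed.

Lemma btw_rot e a b c :
  btw (rot_pos e a) (rot_pos e b) (rot_pos e c) = btw (pos a) (pos b) (pos c).
Proof.
move: (bound a) (bound b) (bound c) (bound e); rewrite /rot_pos /btw; clear.
by do 3!case: ifP; lia.
Qed.

Lemma noncrossing_rot e M : noncrossing (rot_pos e) M <-> noncrossing pos M.
Proof.
by split=> nc S a b c d eS cyc; apply: nc; move: cyc; rewrite // /cyc4 !btw_rot.
Qed.

Lemma bridge_exists M : noncrossing pos M -> (exists x, nontrivial M x) ->
  exists M' e f, [/\ rank M' = rank M, noncrossing pos M',
    bases M' \proper bases M,
    e != f /\ (forall x, 0 < rot_pos e x < rot_pos e f -> ~~ nontrivial M x) &
    forall B, (B \in bases M) = (B \in bases M') ||
      [&& f \in B, e \notin B & e |: (B :\ f) \in bases M'] ].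
Proof.
move=> nc [x0 x0_nt].
pose short l := [exists x, nontrivial M x && (x \in cl M [set y | 0 < rot_pos x y <= l])].
(* The minimum is over all starting points at once, so that it can be used both at [e] and at
   [f]. *)
have [|l /existsP[e /andP[e_nt e_cl]] l_min] := @ex_minnP short.
  exists (\max_y rot_pos x0 y); apply/existsP; exists x0; rewrite x0_nt /=.
  have /andP[_] := x0_nt; apply: mem_clS; apply/subsetP => y; rewrite !inE => yx0.
  rewrite (leq_bigmax y) andbT lt0n -(rot_pos_self x0).
  by apply: contra_neq yx0 => /rot_pos_inj.
have short_min k x : k < l -> nontrivial M x ->
    x \notin cl M [set y | 0 < rot_pos x y <= k].
  move=> lt_k x_nt; apply/negP => xk; have : short k.
    by apply/existsP; exists x; rewrite x_nt.
  by move/l_min; rewrite leqNgt lt_k.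
(* Otherwise only loops and coloops would span [e], making it a loop. *)
have [f0 /andP[f0_nt f0e] f0l] : exists2 f, nontrivial M f && (f != e) & rot_pos e f <= l.
  apply/exists_inP; apply: contraT; rewrite negb_exists_in => /forall_inP h.
  have /andP[/negP e_loop _] := e_nt; case: e_loop.
  apply: (@cl_nontrivial _ _ _ _ [set y | 0 < rot_pos e y <= l]).
  - by rewrite inE rot_pos_self.
  - move=> q; rewrite inE => /andP[q_gt0 q_le]; apply: contraL q_le => q_nt.
    apply: h; rewrite q_nt /=; apply: contraTneq q_gt0 => ->.
    by rewrite rot_pos_self.
  - by rewrite setU0.
have [f /andP[f_nt fe] f_min] :=
  @arg_minnP _ f0 (fun f => nontrivial M f && (f != e)) (rot_pos e)
    (introT andP (conj f0_nt f0e)).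
have f_le : rot_pos e f <= l by apply: leq_trans f0l; apply: f_min; rewrite f0_nt.
have f_gt0 : 0 < rot_pos e f.
  by rewrite lt0n -(rot_pos_self e); apply: contra_neq fe => /rot_pos_inj.
have gap x : 0 < rot_pos e x < rot_pos e f -> ~~ nontrivial M x.
  case/andP=> x_gt0; apply: contraL => x_nt; rewrite -leqNgt; apply: f_min.
  by rewrite x_nt; apply: contraTneq x_gt0 => ->; rewrite rot_pos_self.
(* Seen from [f], this interval has length at most l - rot_pos e f, too short to span [f]. *)
have fZ : f \notin cl M [set x | rot_pos e f < rot_pos e x <= l].
  have lt_l : l - rot_pos e f < l by move: f_gt0 f_le; clear; lia.
  apply: contra (short_min _ _ lt_l f_nt); apply: mem_clS; apply/subsetP => y.
  rewrite !inE; move: (bound y) (bound e) (bound f); rewrite /rot_pos; clear.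
  by do 3!case: ifP; lia.
have eZ : e \in cl M (f |: [set x | rot_pos e f < rot_pos e x <= l]).
  apply: (@cl_nontrivial _ _ _ _ [set x | 0 < rot_pos e x < rot_pos e f]).
  - by rewrite inE rot_pos_self.
  - by move=> q; rewrite inE; apply: gap.
  apply: mem_clS e_cl; apply/subsetP => y; rewrite !inE.
  have [_|/eqP yf] := eqVneq y f; first by rewrite orbT.
  have {yf} : rot_pos e y <> rot_pos e f by move/rot_pos_inj.
  by clear; lia.
have [] := @bridge_step _ _ M e f l (@rot_pos_inj e) _ _ f_gt0 f_le e_nt f_nt gap fZ eZ.
- exact/noncrossing_rot.
- exact: rot_pos_self.
- by move=> k lt_k; apply: short_min.
move=> M' [eM' nc' prop br]; exists M', e, f; split=> //.
  exact/noncrossing_rot/nc'.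
by rewrite eq_sym.
Qed.

End Rotation.

Section Realization.
Variables (R : realFieldType) (U : finType) (pos : U -> nat).
Hypothesis pos_inj : injective pos.
Implicit Types (M : matroid U) (s t : seq U) (a b c d e f x y : U) (B : {set U}).
Local Open Scope ring_scope.

Lemma sorted_enum B : exists s, [/\ uniq s, [set x in s] = B & sorted ltn (map pos s)].
Proof.
exists (sort (relpre pos leq) (enum B)).
have us : uniq (sort (relpre pos leq) (enum B)) by rewrite sort_uniq enum_uniq.
split=> //; first by apply/setP => x; rewrite inE mem_sort mem_enum.
rewrite ltn_sorted_uniq_leq map_inj_uniq // us /= sorted_map.
by apply: sort_sorted => x y; apply: leq_total.
Qed.

(** The non-loops form the only basis: identity columns for them, zero columns for loops. *)
Lemma realization_trivial M : (forall x, ~~ nontrivial M x) ->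
  exists v : U -> 'rV[R]_(rank M), positive_rep pos v (bases M).
Proof.
move=> triv; have [B0 hB0 _] := bases_ext (indep0 M).
have mem_base B x : B \in bases M -> (x \in B) = (x \notin cl M set0).
  exact: trivialP.
have [s0 [us0 es0 ss0]] := sorted_enum B0.
have ms0 x : (x \in s0) = (x \notin cl M set0).
  by rewrite -(mem_base _ _ hB0) -es0 inE.
have zs0 : size s0 = rank M.
  rewrite -(bases_card hB0) -es0 cardE; apply/perm_size/uniq_perm => //.
    exact: enum_uniq.
  by move=> x; rewrite mem_enum inE.
pose v x : 'rV[R]_(rank M) :=
  if x \in s0 then \row_j (index x s0 == j)%:R else 0.
exists v => s us es; have [ss|nss] := boolP (all (fun x => x \in s0) s).
  have ps : perm_eq s s0.
    have [|_ ss0'] := uniq_min_size us (allP ss); first by rewrite es zs0.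
    exact: uniq_perm.
  rewrite (perm_sminor pos_inj _ us es ps).
  have -> : sminor pos v s0 = 1.
    rewrite /sminor inversions_sorted // expr0 mul1r -[RHS](det1 _ (rank M)).
    congr (\det _); apply/matrixP => i j; rewrite !mxE.
    have lt_i : (i < size s0)%N by rewrite zs0.
    have x0 : U by case: (s0) lt_i => [|x].
    rewrite (nth_map x0) // /v mem_nth // mxE index_uniq //.
  rewrite ler01 oner_eq0; split=> //; apply/esym.
  suff -> : [set x in s] = B0 by [].
  by rewrite -es0; apply/setP => x; rewrite !inE (perm_mem ps).
have [x xs xns0] := allPn nss.
have -> : sminor pos v s = 0.
  by apply: (sminor0 pos_inj us es xs); rewrite /v (negPf xns0).
rewrite lexx eqxx; split=> //; apply/esym/negP => hB.
by move: xns0; rewrite ms0 -(mem_base _ _ hB) inE xs.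
Qed.

Lemma count_between t x y : x \notin t -> y \notin t -> (pos x < pos y)%N ->
  count (fun z => (pos z < pos y)%N) t =
  (count (fun z => (pos z < pos x)%N) t + count (fun z => (pos x < pos z < pos y)%N) t)%N.
Proof.
elim: t => //= z t IH; rewrite !inE !negb_or => /andP[xz xt] /andP[yz yt] xy.
rewrite IH //; have : pos x != pos z by apply: contra_neq xz => /pos_inj.
by move: xy; clear; lia.
Qed.

Lemma realization_step M M' (e f : U) : rank M' = rank M -> e != f ->
  (forall x, (0 < rot_pos pos e x < rot_pos pos e f)%N -> ~~ nontrivial M x) ->
  (forall B, (B \in bases M) = (B \in bases M') ||
     [&& f \in B, e \notin B & e |: (B :\ f) \in bases M']) ->
  (exists v : U -> 'rV[R]_(rank M), positive_rep pos v (bases M')) ->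
  exists v : U -> 'rV[R]_(rank M), positive_rep pos v (bases M).
Proof.
move=> eM' ef gap br [v' rep'].
have sub B : B \in bases M' -> B \in bases M by rewrite br => ->.
pose coloops := [set x | (0 < rot_pos pos e x < rot_pos pos e f)%N && (x \notin cl M set0)].
(* The number of elements of a basis e + t strictly between [e] and [f] in [pos]: the coloops of the
   gap if [e] comes first. Otherwise the gap wraps around, and the other elements of [t] lie between
   them. *)
pose k := if (pos e < pos f)%N then #|coloops| else ((rank M).-1 - #|coloops|)%N.
exists (fun x => if x == f then v' f + (-1) ^+ k *: v' e else v' x).
set v := fun x => _; move=> s us es.
have v_id t : f \notin t -> map v t = map v' t.
  by move=> ft; apply/eq_in_map => x xt; rewrite /v; case: eqP ft => // <-; rewrite xt.
have [fs|fs] := boolP (f \in s); last first.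
  have -> : sminor pos v s = sminor pos v' s by rewrite /sminor v_id.
  by have [h1 ->] := rep' s us es; rewrite h1 br inE (negPf fs) orbF.
have [t] : exists t, perm_eq s (f :: t) by exists (rem f s); apply: perm_to_rem.
move=> pst; have := perm_uniq pst; rewrite us => /esym /= /andP[ft ut].
have et : (size t).+1 = rank M by rewrite -es (perm_size pst).
have r_gt0 : (0 < rank M)%N by rewrite -et.
have -> : [set x in s] = f |: [set x in t].
  by apply/setP => x; rewrite !inE (perm_mem pst) inE.
have -> : sminor pos v s = sminor pos v' (f :: t) +
    (-1) ^+ count (fun y => (pos y < pos f)%N) t *
    ((-1) ^+ inversions pos t * ((-1) ^+ k * dets (v' e :: map v' t))).
  rewrite (perm_sminor pos_inj _ us es pst) sminor_cons v_id // {1}/v eqxx.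
  by rewrite dets_linear // !mulrDr -sminor_cons.
have ftS : f \notin [set x in t] by rewrite inE.
rewrite br setU11 setU1K // in_setU1 negb_or ef in_set /=.
have [h1 h2] : 0 <= sminor pos v' (f :: t) /\
    (sminor pos v' (f :: t) != 0) = (f |: [set x in t] \in bases M').
  rewrite -set_cons; apply: rep' => //=; first by rewrite ft.
have [et'|et'] := boolP (e \in t).
  rewrite [dets (v' e :: _)]dets_alternate ?size_map ?map_f // !mulr0 addr0.
  by rewrite orbF.
have [h3 h4] : 0 <= sminor pos v' (e :: t) /\
    (sminor pos v' (e :: t) != 0) = (e |: [set x in t] \in bases M').
  rewrite -set_cons; apply: rep' => //=; first by rewrite et'.
(* A sum of two nonnegative minors is nonzero iff one of them is, which is the disjunction in
   [br]. *)
set z := (X in sminor pos v' (f :: t) + X); suff ez : z = sminor pos v' (e :: t).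
  by rewrite ez addr_ge0 // paddr_eq0 // negb_and h2 h4.
have ez : z = (-1) ^+ (k + count (fun y => pos y < pos f)%N t +
   count (fun y => pos y < pos e)%N t) * sminor pos v' (e :: t).
  rewrite /z sminor_cons !exprD.
  have := sqrr_sign R (count (fun y => pos y < pos e)%N t); rewrite expr2.
  move: ((-1) ^+ _ : R) ((-1) ^+ _ : R) ((-1) ^+ _ : R) ((-1) ^+ _ : R) (dets _).
  by move=> q1 q2 q3 q4 D q1q1; rewrite -[LHS]mul1r -q1q1; ring.
rewrite ez; have [->|zN0] := eqVneq (sminor pos v' (e :: t)) 0; first by rewrite mulr0.
have hB : e |: [set x in t] \in bases M by apply: sub; rewrite -h4.
suff ok : ~~ odd (k + count (fun y => pos y < pos f)%N t + count (fun y => pos y < pos e)%N t)%N.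
  by rewrite -signr_odd (negPf ok) mul1r.
have pef : pos e != pos f by apply: contra_neq ef => /pos_inj.
have ecol : #|coloops| = count (fun y => 0 < rot_pos pos e y < rot_pos pos e f)%N t.
  rewrite -size_filter -(card_uniqP (filter_uniq _ ut)); apply: eq_card => y.
  rewrite inE mem_filter; case gy: (_ < _ < _)%N => //=.
  rewrite -(trivialP (gap y gy) hB) !inE; case: eqP gy => // ->.
  by rewrite rot_pos_self.
have bound x : (pos x <= \max_y pos y)%N by apply: leq_bigmax.
have be := bound e; have bf := bound f.
case: (ltngtP (pos e) (pos f)) pef => // [lt_ef|lt_fe] _.
  rewrite /k lt_ef (count_between et' ft lt_ef) ecol.
  rewrite [X in (X + _ + _)%N](@eq_count _ _ (fun z => pos e < pos z < pos f)%N).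
    by rewrite !oddD; do 2!case: (odd _).
  move=> y; move: (bound y) be bf lt_ef; rewrite /rot_pos; clear.
  by do 2!case: ifP; lia.
rewrite /k ltnNge ltnW //= (count_between ft et' lt_fe).
suff -> : ((rank M).-1 - #|coloops| = count (fun z => pos f < pos z < pos e) t)%N.
  by rewrite !oddD; do 2!case: (odd _).
rewrite ecol -et /= -(count_predC (fun z => pos f < pos z < pos e)%N t).
rewrite [X in (_ - X)%N](@eq_in_count _ _ (predC (fun z => pos f < pos z < pos e)%N)).
  by rewrite addnK.
move=> y yt /=.
have ye : pos y != pos e by apply: contraNneq et' => /pos_inj <-.
have yf : pos y != pos f by apply: contraNneq ft => /pos_inj <-.
move: ye yf (bound y) be bf lt_fe; rewrite /rot_pos; clear.
by do 2!case: ifP; lia.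
Qed.

Theorem realization M : noncrossing pos M ->
  exists v : U -> 'rV[R]_(rank M), positive_rep pos v (bases M).
Proof.
have [n] := ubnP #|bases M|; elim: n M => // n IH M /ltnSE le_n nc.
have [/existsP ex_nt|] := boolP [exists x, nontrivial M x]; last first.
  by rewrite negb_exists => /forallP; apply: realization_trivial.
have [M' [e [f [eM' nc' prop [ef gap] br]]]] := bridge_exists pos_inj nc ex_nt.
apply: (realization_step eM' ef gap br); rewrite -eM'; apply: IH nc'.
exact: leq_trans (proper_card prop) le_n.
Qed.
End Realization.

(** * Clones *)

Section Clones.
Variables (U : finType) (M : matroid U) (T : {set U}).
Hypothesis cloneT : clone_set M T.
Implicit Types (A B I J S X : {set U}) (x y a b c d : U).

Lemma tperm_imset x y A : x \notin A -> y \notin A ->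
  tperm x y @: A = A.
Proof.
move=> xA yA; rewrite -[RHS]imset_id; apply: eq_in_imset => z zA.
by rewrite tpermD //; [apply: contraNneq xA|apply: contraNneq yA] => ->.
Qed.

Lemma clone_swap x y A : x \in T -> y \in T -> x \notin A -> y \notin A ->
  (x |: A \in indep M) = (y |: A \in indep M).
Proof.
move=> xT yT xA yA; have [->//|xy] := eqVneq x y.
have [TM /(_ x y xT yT xy)[xM yM [_ h]]] := cloneT.
have [AM|AM] := boolP (A \subset ground M); last first.
  suff nA z : z |: A \in indep M = false by rewrite !nA.
  apply: contraNF AM => /indep_ground; apply: subset_trans; exact: subsetUr.
have := h (x |: A); rewrite subUset sub1set xM AM => /(_ isT) <-.
by rewrite imsetU1 tpermL tperm_imset.
Qed.

Lemma clone_swap_bases x y A : x \in T -> y \in T -> x \notin A -> y \notin A ->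
  (x |: A \in bases M) = (y |: A \in bases M).
Proof.
by move=> xT yT xA yA; rewrite !inE (clone_swap xT yT xA yA) !cardsU1 xA yA.
Qed.

(** Clone swaps replace elements of T1 - T2 by elements of T2 - T1 until [T2] is covered, so only
    the number taken from [T] counts. *)
Lemma clone_indep A (T1 T2 : {set U}) : [disjoint A & T] -> T1 \subset T -> T2 \subset T ->
  #|T2| <= #|T1| -> A :|: T1 \in indep M -> A :|: T2 \in indep M.
Proof.
move=> AT; have [n] := ubnP #|T2 :\: T1|.
elim: n T1 => // n IH T1 /ltnSE le_n T1T T2T le_T hA.
have [T21|[x xT21]] := set_0Vmem (T2 :\: T1).
  apply: indepS hA; apply: setUS; apply/subsetP => z zT2; apply: contraT => zT1.
  by have := in_set0 z; rewrite -T21 inE zT1 zT2.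
have [xT2 xT1] := setDP xT21.
have [y /setDP[yT1 yT2]] : exists y, y \in T1 :\: T2.
  apply/set0Pn; rewrite -card_gt0.
  have := cardsID T1 T2; have := cardsID T2 T1; rewrite (setIC T2 T1).
  have : 0 < #|T2 :\: T1| by apply/card_gt0P; exists x.
  move: le_T; clear; lia.
have xT := subsetP T2T x xT2; have yT := subsetP T1T y yT1.
have notA z : z \in T -> z \notin A by move=> zT; rewrite (disjointFl AT).
have xy : x != y by apply: contraNneq xT1 => ->.
apply: (IH (x |: T1 :\ y)) => //.
- apply: leq_trans le_n; apply: proper_card; apply/properP; split.
    apply/subsetP => z; rewrite !inE negb_or !negb_and negbK => /andP[/andP[zx]].
    by case/orP => [/eqP->|-> ->]; rewrite // (negPf yT2).
  by exists x => //; rewrite !inE eqxx.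
- by rewrite subUset sub1set xT (subset_trans (subsetDl _ _) T1T).
- by move: le_T; rewrite (cardsD1 y T1) yT1 cardsU1 !inE (negPf xT1) andbF.
rewrite setUCA -(clone_swap yT xT); last 2 first.
- by rewrite !inE eqxx orbF (negPf (notA _ yT)).
- by rewrite !inE (negPf xT1) andbF orbF (negPf (notA _ xT)).
by rewrite setUCA setD1K.
Qed.

Lemma clone_bases_imset x y B : x \in T -> y \in T -> B \subset ground M ->
  (tperm x y @: B \in bases M) = (B \in bases M).
Proof.
move=> xT yT BM; have [->|xy] := eqVneq x y.
  by rewrite tperm1 (eq_imset _ (@perm1 _)) imset_id.
have [_ /(_ x y xT yT xy)[_ _ [_ h]]] := cloneT.
by rewrite !inE h // card_imset //; apply: perm_inj.
Qed.

(** The span of c + S is a hyperplane and cannot contain both [a] and [b]. *)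
Lemma bases_pair_exchange a b c d S : a |: (b |: S) \in bases M ->
  c |: (d |: S) \in bases M -> #|S|.+2 = rank M ->
  (a |: (c |: S) \in bases M) || (b |: (c |: S) \in bases M).
Proof.
move=> hab hcd eS; have dS : d \notin c |: S.
  have := bases_card hcd; rewrite -eS setUCA cardsU1; case: (_ \in _) => //=.
  by rewrite add0n cardsU1; case: (_ \in _) => /=; clear; lia.
have [] := basesD1 hcd (x := d); first by rewrite !inE eqxx orbT.
rewrite setUCA setU1K // => hI eI _.
rewrite !basesU1 // -negb_and; apply/negP => /andP[acl bcl].
have : rk M (a |: (b |: S)) <= rk M (c |: S).
  apply: rk_spanS; rewrite !subUset !sub1set acl bcl.
  exact: subset_trans (subsetUr _ _) (sub_cl _ _).
by rewrite (rk_cards (bases_indep hab)) (rk_cards hI) (bases_card hab) -eI ltnn.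
Qed.

(* Moving all clones of tau next to tau keeps a matroid noncrossing: a crossing
   involving two adjacent clones x, y is excluded because exchanging x and y
   would turn a crossing circuit and cocircuit into ones sharing one element. *)
Lemma noncrossing_clones (pos0 pos : U -> nat) tau :
  let rho x := if x \in T then tau else x in
  tau \in T ->
  (forall a b c, a \in ground M -> b \in ground M -> c \in ground M ->
     uniq [:: rho a; rho b; rho c] -> btw (pos a) (pos b) (pos c) ->
     btw (pos0 (rho a)) (pos0 (rho b)) (pos0 (rho c))) ->
  (forall a b c d, a \in T -> c \in T -> b \in ground M -> d \in ground M ->
     cyc4 pos a b c d -> (b \in T) || (d \in T)) ->
  noncrossing pos0 M -> noncrossing pos M.
Proof.
move=> rho tauT pos_rho block nc S a b c d eS cyc hab hcd.
have gM x y B : x |: (y |: B) \in bases M ->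
    [/\ x \in ground M, y \in ground M & B \subset ground M].
  by move=> /bases_indep/indep_ground; rewrite !subUset !sub1set => /and3P[].
have [aM bM SM] := gM _ _ _ hab; have [cM dM _] := gM _ _ _ hcd.
have nS x y : x |: (y |: S) \in bases M -> [/\ x != y, x \notin S & y \notin S].
  move=> /bases_card; rewrite !cardsU1 in_setU1 negb_or -eS.
  by case: (x != y) (x \in S) (y \in S) => [] [] [] //=; clear; lia.
have [ab aS bS] := nS _ _ hab; have [cd cS dS] := nS _ _ hcd.
have [ac ad [bc bd]] : [/\ a != c, a != d & b != c /\ b != d].
  have neq x y : pos x != pos y -> x != y by apply: contra_neq => ->.
  by split; [| |split]; apply: neq; move: cyc; rewrite /cyc4 /btw; clear; lia.
have notin x y : x != y -> x \notin S -> y \notin S ->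
    (x \notin y |: S) * (y \notin x |: S).
  by move=> xy xS yS; rewrite !inE !negb_or xS yS (eq_sym y) xy.
have [nac1 nac2] := notin _ _ ac aS cS; have [nad1 nad2] := notin _ _ ad aS dS.
have [nbc1 nbc2] := notin _ _ bc bS cS; have [ncd1 ncd2] := notin _ _ cd cS dS.
have [nab1 nab2] := notin _ _ ab aS bS.
(* With two of the four points in [T], a clone swap in a given basis settles neighbouring pairs; the
   opposite pairs a, c and b, d would force a third point into the block [T]. *)
have [/andP[aT bT]|nab] := boolP ((a \in T) && (b \in T)).
  have /orP[//|] := bases_pair_exchange hab hcd eS.
  by rewrite (clone_swap_bases bT aT).
have [/andP[cT dT]|ncd] := boolP ((c \in T) && (d \in T)).
  have /orP[|] := bases_pair_exchange hcd hab eS; first by rewrite setUCA.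
  by rewrite (clone_swap_bases dT cT) // setUCA.
have [/andP[aT dT]|nad] := boolP ((a \in T) && (d \in T)).
  by rewrite (clone_swap_bases aT dT) // setUCA.
have [/andP[bT cT]|nbc] := boolP ((b \in T) && (c \in T)).
  by rewrite setUCA (clone_swap_bases cT bT) // setUCA.
have [/andP[aT cT]|nac] := boolP ((a \in T) && (c \in T)).
  have := block a b c d aT cT bM dM cyc.
  by move: nab ncd; rewrite aT cT /= => /negPf-> /negPf->.
have [/andP[bT dT]|nbd] := boolP ((b \in T) && (d \in T)).
  have cyc' : cyc4 pos b c d a by move: cyc; rewrite /cyc4 /btw; clear; lia.
  have := block b c d a bT dT cM aM cyc'.
  by move: nbc nad; rewrite bT dT andbT /= => /negPf-> /negPf->.
have [t tT ht] : exists2 t, t \in T & forall x, x \in [:: a; b; c; d] -> x \in T -> x = t.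
  have [/existsP[t /andP[tx tT]]|none] := boolP [exists t, (t \in [:: a; b; c; d]) && (t \in T)].
    exists t => // x xs xT; rewrite !inE in tx xs.
    case/or4P: tx => /eqP et; case/or4P: xs => /eqP ex; subst t x => //;
      by move: nab ncd nad nbc nac nbd; rewrite tT xT.
  exists tau => // x xs xT; case/existsP: none; exists x; by rewrite xs.
(* Now at most one of the four points is in [T]; swapping it with [tau] carries the crossing over to
   the order [pos0]. *)
pose s := tperm t tau.
have sE x : x \in [:: a; b; c; d] -> s x = rho x.
  move=> xs; rewrite /rho; case: ifP => [xT|/negbT xT]; first by rewrite (ht x) // tpermL.
  by rewrite tpermD //; [apply: contraNneq xT|apply: contraNneq xT] => <-.
have imE x y : s @: (x |: (y |: S)) = s x |: (s y |: s @: S) by rewrite !imsetU1.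
have acM : a |: (c |: S) \subset ground M by rewrite !subUset !sub1set aM cM.
rewrite -(clone_bases_imset tT tauT acM) imE.
have es : #|s @: S|.+2 = rank M by rewrite card_imset //; apply: perm_inj.
apply: (nc _ _ (s b) _ (s d) es).
- have u x y z : x != y -> x != z -> y != z -> uniq [:: s x; s y; s z].
    by move=> xy xz yz; rewrite /= !inE !(inj_eq perm_inj) negb_or xy xz yz.
  rewrite /cyc4 !sE ?inE ?eqxx ?orbT //.
  case/andP: cyc => c1 c2; rewrite !pos_rho // -!sE ?inE ?eqxx ?orbT //; exact: u.
- by rewrite -imE clone_bases_imset // !subUset !sub1set aM bM.
- by rewrite -imE clone_bases_imset // !subUset !sub1set cM dM.
Qed.

End Clones.

Lemma rk_restrict (U : finType) (M : matroid U) (X A : {set U}) :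
  A \subset X -> rk (restrict M X) A = rk M A.
Proof.
move=> AX; apply: eq_bigl => I; rewrite inE -andbA.
by case: (boolP (I \subset A)) => [/subset_trans/(_ AX)->|_]; rewrite ?andbF ?andbT.
Qed.

(** * The free amalgam *)

Section Amalgam.
Variable U : finType.
Implicit Types (M N K : matroid U) (T I J A X : {set U}) (x : U).

(* For independent A = I :\: ground N and C = I :\: ground M, the generic
   overlap of the spans of A and C inside the span of T is measured by the
   nullities of A :|: T and C :|: T; these and #|I :&: T| must fit into #|T|. *)
Definition amalgam_indep M N T I : bool :=
  [&& I \subset ground M :|: ground N,
      I :&: (ground M :\: T) \in indep M,
      I :&: (ground N :\: T) \in indep N &
      #|I| + #|T| <= rk M (I :&: (ground M :\: T) :|: T) +
                     rk N (I :&: (ground N :\: T) :|: T)].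

Lemma amalgam_indepC M N T I : amalgam_indep M N T I = amalgam_indep N M T I.
Proof.
by rewrite /amalgam_indep setUC [in X in _ && X]andbCA [in X in _ <= X]addnC.
Qed.

Section Pair.
Variables (M N : matroid U) (T : {set U}).
Hypothesis defT : T = ground M :&: ground N.
Local Notation X := (ground M :\: T).
Local Notation Y := (ground N :\: T).

Lemma TsubM : T \subset ground M.
Proof. by rewrite defT subsetIl. Qed.

Lemma TsubN : T \subset ground N.
Proof. by rewrite defT subsetIr. Qed.

Lemma XY x : x \in X -> x \notin Y.
Proof.
by rewrite defT !inE; case: (x \in ground M); case: (x \in ground N).
Qed.

Lemma card_split I : I \subset ground M :|: ground N ->
  #|I| = #|I :&: X| + #|I :&: Y| + #|I :&: T|.
Proof.
move=> IMN; rewrite -(cardsID T I) addnC; congr (_ + _).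
rewrite -(cardsID (ground M) (I :\: T)); congr (_ + _); apply: eq_card => x.
  by rewrite !inE andbA andbC; case: (x \in I); case: (x \in T); case: (x \in ground M).
have := subsetP IMN x; rewrite defT !inE.
by case: (x \in I); case: (x \in ground M); case: (x \in ground N) => //= /(_ isT).
Qed.

(** Each element removed lowers #|I| by one and lowers the sum of the two rank terms by at most
    one. *)
Lemma amalgam_indepS I J : J \subset I -> amalgam_indep M N T I ->
  amalgam_indep M N T J.
Proof.
move=> JI /and4P[IE IM IN le].
have JX := setSI X JI; have JY := setSI Y JI; have JT := setSI T JI.
apply/and4P; split; [exact: subset_trans IE|exact: indepS IM|exact: indepS IN|].
have sub (A B : {set U}) : B \subset A -> A :|: T \subset (B :|: T) :|: (A :\: B).
  move=> BA; apply/subsetP => x; rewrite !inE.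
  by case: (x \in B); case: (x \in T); case: (x \in A).
have := leq_trans (rkS M (sub _ _ JX)) (rkU _ _ _).
have := leq_trans (rkS N (sub _ _ JY)) (rkU _ _ _).
rewrite !cardsD (setIidPr JX) (setIidPr JY).
have := subset_leq_card JX; have := subset_leq_card JY; have := subset_leq_card JT.
move: le; rewrite (card_split IE) (card_split (subset_trans JI IE)).
clear; lia.
Qed.

Lemma amalgam_indep_add I x : amalgam_indep M N T I -> x \in X -> x \notin I ->
  x \notin cl M (I :&: X) ->
  (x \notin cl M (I :&: X :|: T)) ||
  (#|I| + #|T| < rk M (I :&: X :|: T) + rk N (I :&: Y :|: T)) ->
  amalgam_indep M N T (x |: I).
Proof.
move=> /and4P[IE IM IN le] xX xI xcl h.
have xIX : (x |: I) :&: X = x |: (I :&: X).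
  by rewrite setIUl (setIidPl _) ?sub1set.
have xIY : (x |: I) :&: Y = I :&: Y.
  by rewrite setIUl disjoint_setI0 ?set0U // disjoints1 XY.
rewrite /amalgam_indep xIX xIY subUset IE sub1set inE.
have -> : x \in ground M by case/setDP: xX.
rewrite indepU1 // ?xcl ?IN /=; last by rewrite inE (negPf xI).
rewrite cardsU1 xI -setUA; case/orP: h => [|h].
  by rewrite notin_clE => /eqP ->; rewrite add1n !addSn ltnS.
by rewrite add1n addSn; apply: leq_trans h _; rewrite leq_add2r rkS // subsetUr.
Qed.

End Pair.

Section Construction.
Variables (M N : matroid U) (T : {set U}).
Hypothesis defT : T = ground M :&: ground N.
Hypotheses (indepM : T \in indep M) (indepN : T \in indep N).
Local Notation X := (ground M :\: T).
Local Notation Y := (ground N :\: T).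

Let defT' : T = ground N :&: ground M. Proof. by rewrite setIC. Qed.

(** If nothing can be added, the spans with [T] leave slack in the inequality for [I]; given slack,
    only closure obstructs an addition, so [I] spans [J] part by part and #|J| <= #|I|. *)
Lemma amalgam_aug I J : amalgam_indep M N T I -> amalgam_indep M N T J ->
  #|I| < #|J| -> exists2 x, x \in J :\: I & amalgam_indep M N T (x |: I).
Proof.
move=> hI hJ ltIJ; apply/exists_inP; apply: contraT.
rewrite negb_exists_in => /forall_inP none.
have [IE IM IN le] := and4P hI; have [JE JM JN leJ] := and4P hJ.
have noX x : x \in J -> x \in X -> x \notin cl M (I :&: X) ->
    ~~ ((x \notin cl M (I :&: X :|: T)) ||
        (#|I| + #|T| < rk M (I :&: X :|: T) + rk N (I :&: Y :|: T))).
  move=> xJ xX xcl; have xI : x \notin I.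
    by apply: contra xcl => xI; apply: mem_cl; rewrite inE xI.
  apply: contra (none x _); last by rewrite inE xI.
  exact: amalgam_indep_add.
have noY x : x \in J -> x \in Y -> x \notin cl N (I :&: Y) ->
    ~~ ((x \notin cl N (I :&: Y :|: T)) ||
        (#|I| + #|T| < rk M (I :&: X :|: T) + rk N (I :&: Y :|: T))).
  move=> xJ xX xcl; have xI : x \notin I.
    by apply: contra xcl => xI; apply: mem_cl; rewrite inE xI.
  apply: contra (none x _); last by rewrite inE xI.
  rewrite [X in _ || (_ < X)]addnC !(amalgam_indepC M).
  by apply: amalgam_indep_add; rewrite // amalgam_indepC.
have JX : J :&: X \subset cl M (I :&: X :|: T).
  apply/subsetP => x /setIP[xJ xX]; have [|] := boolP (x \in cl M (I :&: X)).
    exact: mem_clS (subsetUl _ _).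
  by move/(noX x xJ xX); rewrite negb_or negbK => /andP[].
have JY : J :&: Y \subset cl N (I :&: Y :|: T).
  apply/subsetP => x /setIP[xJ xX]; have [|] := boolP (x \in cl N (I :&: Y)).
    exact: mem_clS (subsetUl _ _).
  by move/(noY x xJ xX); rewrite negb_or negbK => /andP[].
have subT K A : T \subset cl K (A :|: T).
  by apply: subset_trans (subsetUr _ _) (sub_cl _ _).
have slack : #|I| + #|T| < rk M (I :&: X :|: T) + rk N (I :&: Y :|: T).
  have : rk M (J :&: X :|: T) <= rk M (I :&: X :|: T).
    by apply: rk_spanS; rewrite subUset JX subT.
  have : rk N (J :&: Y :|: T) <= rk N (I :&: Y :|: T).
    by apply: rk_spanS; rewrite subUset JY subT.
  move: leJ ltIJ; clear; lia.
have JX' : J :&: X \subset cl M (I :&: X).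
  apply/subsetP => x /setIP[xJ xX]; apply: contraT => /(noX x xJ xX).
  by rewrite slack orbT.
have JY' : J :&: Y \subset cl N (I :&: Y).
  apply/subsetP => x /setIP[xJ xX]; apply: contraT => /(noY x xJ xX).
  by rewrite slack orbT.
have JT : J :&: T \subset I :&: T.
  apply/subsetP => x /setIP[xJ xT]; rewrite inE xT andbT; apply: contraT => xI.
  have xJI : x \in J :\: I by rewrite inE xI.
  case/negP: (none x xJI).
  have xX : x \notin X by rewrite inE xT.
  have xY : x \notin Y by rewrite inE xT.
  rewrite /amalgam_indep !setIUl ![[set x] :&: _]disjoint_setI0 ?disjoints1 // !set0U.
  rewrite IM IN subUset IE sub1set inE (subsetP (TsubM defT)) //=.
  by rewrite cardsU1 xI add1n addSn.
have := subset_leq_card JT; have := rk_spanS JX'; have := rk_spanS JY'.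
rewrite (rk_cards JM) (rk_cards JN) (rk_cards IM) (rk_cards IN).
move: ltIJ; rewrite (card_split defT IE) (card_split defT JE); clear; lia.
Qed.

Lemma amalgam_axiom :
  matroid_axiom (ground M :|: ground N) [set I | amalgam_indep M N T I].
Proof.
apply/and4P; split.
- rewrite inE /amalgam_indep sub0set !set0I !indep0 !set0U cards0 /=.
  by rewrite (rk_cards indepM) (rk_cards indepN) leq_addr.
- by apply/forall_inP => I; rewrite inE => /and4P[].
- apply/forall_inP => I; rewrite inE => hI; apply/forallP => J; apply/implyP => JI.
  by rewrite inE; apply: amalgam_indepS hI.
apply/forall_inP => I; rewrite inE => hI; apply/forall_inP => J; rewrite inE => hJ.
apply/implyP => ltIJ; apply/exists_inP.
have [x xJI hx] := amalgam_aug hI hJ ltIJ.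
by exists x => //; rewrite inE.
Qed.

Definition free_amalgam : matroid U := Matroid amalgam_axiom.

End Construction.
End Amalgam.

Lemma setDUK (T : finType) (A B : {set T}) : B \subset A -> A :\: B :|: B = A.
Proof. by move=> BA; rewrite setUC -{1}(setIidPr BA) setID. Qed.

Section Free.
Variable U : finType.
Implicit Types (I J A B S : {set U}) (a b c d x : U).

(** On [ground M] the inequality reads #|I| <= rk (A + T). Extending A to a maximal independent
    subset of A + T uses at least as many elements of [T] as [I] does, and clones allow these to be
    traded for the ones in [I]. *)
Lemma restrict_free_amalgam (M N : matroid U) (T : {set U})
    (defT : T = ground M :&: ground N) (indepM : T \in indep M)
    (indepN : T \in indep N) : clone_set M T ->
  restrict (free_amalgam defT indepM indepN) (ground M) = M.
Proof.
move=> cloneM; apply: matroid_inj => /=.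
  by rewrite setIUl setIid (setUidPl _) ?subsetIr.
have TM := TsubM defT.
have eI I : I \subset ground M -> I = (I :&: (ground M :\: T)) :|: (I :&: T).
  move=> IM; apply/setP => x; have := subsetP IM x; rewrite !inE.
  by case: (x \in I); case: (x \in ground M); case: (x \in T) => //= /(_ isT).
have IY0 I : I \subset ground M -> I :&: (ground N :\: T) = set0.
  move=> IM; apply/setP => x; have := subsetP IM x; rewrite defT !inE.
  by case: (x \in I); case: (x \in ground M); case: (x \in ground N) => //= /(_ isT).
apply/setP => I; rewrite !inE; apply/andP/idP => [[/and4P[_ IX _ le] IM]|hI].
  move: le; rewrite (IY0 _ IM) set0U (rk_cards indepN) leq_add2r => le.
  have [J [hJ IJ JX eJ]] := rk_indep IX (subsetUl (I :&: (ground M :\: T)) T).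
  have eJ2 : J = (I :&: (ground M :\: T)) :|: (J :&: T).
    apply/eqP; rewrite eqEsubset subUset IJ subsetIl !andbT.
    apply/subsetP => x xJ; have := subsetP JX x xJ.
    by rewrite 2!in_setU [x \in J :&: T]in_setI xJ.
  have dT : [disjoint I :&: (ground M :\: T) & T].
    by rewrite disjoints_subset; apply/subsetP => x; rewrite !inE => /and3P[_ ->].
  rewrite (eI _ IM); apply: (clone_indep cloneM (T1 := J :&: T)) => //.
  - exact: subsetIr.
  - exact: subsetIr.
  - have := cardsUI (I :&: (ground M :\: T)) (I :&: T).
    have := cardsUI (I :&: (ground M :\: T)) (J :&: T).
    rewrite -eJ2 -(eI _ IM) eJ.
    rewrite ![(I :&: (ground M :\: T)) :&: _]setIC -!setIA.
    rewrite ![T :&: _](disjoint_setI0 (B := I :&: (ground M :\: T))) 1?disjoint_sym //.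
    by rewrite !setI0 !cards0; move: le; clear; lia.
  - by rewrite -eJ2.
have IM := indep_ground hI.
rewrite /amalgam_indep (IY0 _ IM) IM indep0 (indepS (subsetIl _ _) hI).
rewrite (subset_trans IM (subsetUl _ _)) set0U (rk_cards indepN) leq_add2r.
split=> //=; apply: leq_rk => //; rewrite {1}(eI _ IM).
by apply: setUS; apply: subsetIr.
Qed.

(** Among subsets of [ground L :\: T], these are the traces of the bases of [L]. *)
Definition spans_with (T : {set U}) (L : matroid U) A : bool :=
  (A \in indep L) && (rk L (A :|: T) == rank L).

Section Pair.
Variables (M N : matroid U) (T : {set U}).
Hypothesis defT : T = ground M :&: ground N.
Hypotheses (indepM : T \in indep M) (indepN : T \in indep N).
Hypotheses (cloneM : clone_set M T) (cloneN : clone_set N T).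
Local Notation X := (ground M :\: T).
Local Notation Y := (ground N :\: T).
Local Notation K := (free_amalgam defT indepM indepN).

Lemma free_amalgam_is_amalgam : is_amalgam M N K.
Proof.
split=> //; first exact: restrict_free_amalgam.
have defT' : T = ground N :&: ground M by rewrite setIC.
rewrite -[RHS](restrict_free_amalgam defT' indepN indepM cloneN).
congr restrict; apply: matroid_inj; first by rewrite /= setUC.
by apply/setP => I; rewrite !inE amalgam_indepC.
Qed.

Lemma free_amalgam_is_free : is_free_amalgam M N K.
Proof.
split; first exact: free_amalgam_is_amalgam.
move=> K' [gK rM rN] I hI.
have subX : I :&: X :|: T \subset ground M.
  by rewrite subUset (TsubM defT) andbT; apply: subset_trans (subsetIr _ _) (subsetDl _ _).
have subY : I :&: Y :|: T \subset ground N.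
  by rewrite subUset (TsubN defT) andbT; apply: subset_trans (subsetIr _ _) (subsetDl _ _).
have IK : I \subset ground M :|: ground N by rewrite -gK indep_ground.
have ind (L : matroid U) A : restrict K' (ground L) = L -> A \subset I ->
    A \subset ground L -> A \in indep L.
  by move=> eL AI AL; rewrite -eL inE (indepS AI hI) AL.
rewrite inE /amalgam_indep IK !ind ?subsetIl //=; last 2 first.
- by apply: subset_trans (subsetIr _ _) (subsetDl _ _).
- by apply: subset_trans (subsetIr _ _) (subsetDl _ _).
have rk_r (L : matroid U) A : restrict K' (ground L) = L -> A \subset ground L ->
  rk L A = rk K' A by move=> eL AL; rewrite -[in LHS]eL rk_restrict.
rewrite !rk_r //.
apply: leq_trans (rk_submod _ _ _); apply: leq_add.
  rewrite -(rk_cards hI); apply: rkS; apply/subsetP => x xI.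
  have := subsetP IK x xI; rewrite !inE xI.
  by case: (x \in T); case: (x \in ground M); case: (x \in ground N).
have TK : T \in indep K' by move: indepM; rewrite -rM inE => /andP[].
by rewrite -(rk_cards TK) rkS // subsetI !subsetUr.
Qed.

(** The inequality gives the upper bound; a basis of M and a basis of N, both extending [T], have a
    union that attains it. *)
Lemma rank_free_amalgam : rank K + #|T| = rank M + rank N.
Proof.
apply/eqP; rewrite eqn_leq; apply/andP; split.
  have [B /basesP[hB <-] _] := bases_ext (indep0 K).
  move: hB; rewrite inE => /and4P[_ _ _ le]; apply: leq_trans le _.
  by apply: leq_add; apply: rk_le_rank.
have [BM hBM TBM] := bases_ext indepM; have [BN hBN TBN] := bases_ext indepN.
have gBM := indep_ground (bases_indep hBM); have gBN := indep_ground (bases_indep hBN).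
have iT : BM :&: BN = T.
  apply/eqP; rewrite eqEsubset subsetI TBM TBN !andbT defT subsetI.
  by rewrite (subset_trans (subsetIl _ _) gBM) (subset_trans (subsetIr _ _) gBN).
have eX : (BM :|: BN) :&: X = BM :\: T.
  apply/setP => x; have := subsetP gBM x; have := subsetP gBN x.
  rewrite defT !inE; case: (x \in BM); case: (x \in BN); case: (x \in ground M);
    by case: (x \in ground N) => //= h1 h2; rewrite ?(h1 isT) ?(h2 isT).
have eY : (BM :|: BN) :&: Y = BN :\: T.
  apply/setP => x; have := subsetP gBM x; have := subsetP gBN x.
  rewrite defT !inE; case: (x \in BM); case: (x \in BN); case: (x \in ground M);
    by case: (x \in ground N) => //= h1 h2; rewrite ?(h1 isT) ?(h2 isT).
have hB : BM :|: BN \in indep K.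
  rewrite inE /amalgam_indep eX eY setUSS //=.
  rewrite !(indepS (subsetDl _ _)) ?bases_indep //=.
  rewrite !setDUK // (rk_cards (bases_indep hBM)) (rk_cards (bases_indep hBN)).
  by rewrite -(cardsUI BM BN) iT.
have := leq_rk hB (subsetT _); rewrite rk_setT.
have := cardsUI BM BN; rewrite iT (bases_card hBM) (bases_card hBN).
by clear; lia.
Qed.

(** At full size the defining inequality forces both rank terms to be maximal, so the two sides
    decouple. *)
Lemma bases_free_amalgam B : (B \in bases K) =
  [&& B \subset ground M :|: ground N, #|B| == rank K,
      spans_with T M (B :&: X) & spans_with T N (B :&: Y)].
Proof.
apply/idP/idP => [/basesP[hB eB]|/and4P[BK eB /andP[hX /eqP eX] /andP[hY /eqP eY]]].
  move: hB; rewrite inE => /and4P[-> hX hY le].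
  rewrite eB eqxx /spans_with hX hY /=; move: le; rewrite eB rank_free_amalgam.
  have := rk_le_rank M (B :&: X :|: T); have := rk_le_rank N (B :&: Y :|: T).
  by clear; lia.
apply/basesP; split; last exact/eqP.
by rewrite inE /amalgam_indep BK hX hY eX eY (eqP eB) rank_free_amalgam /=.
Qed.

End Pair.

Lemma subset_of_card (A : {set U}) k : k <= #|A| -> exists2 B : {set U}, B \subset A & #|B| = k.
Proof.
elim: k => [|k IH] le; first by exists set0; rewrite ?sub0set ?cards0.
have [B BA eB] := IH (ltnW le).
have /subsetPn[x xA xB] : ~~ (A \subset B).
  by apply: contraL le => /subset_leq_card; rewrite eB -ltnNge ltnS.
by exists (x |: B); rewrite ?subUset ?sub1set ?xA ?BA // cardsU1 xB eB.
Qed.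

(** * Crossings on one side of the amalgam *)

Section Side.
Variables (L : matroid U) (T : {set U}) (pos : U -> nat).
Hypothesis cloneL : clone_set L T.
Hypothesis ncL : noncrossing pos L.
Local Notation X := (ground L :\: T).
Local Notation spans := (spans_with T L).

Lemma X_disjoint A : A \subset X -> [disjoint A & T].
Proof. by rewrite subsetD => /andP[]. Qed.

Lemma spans_bases A (T' : {set U}) : A \subset X -> T' \subset T ->
  #|A| + #|T'| = rank L -> spans A = (A :|: T' \in bases L).
Proof.
move=> AX T'T eA; have AT := X_disjoint AX.
have dAT' (T1 : {set U}) : T1 \subset T -> #|A :|: T1| = #|A| + #|T1|.
  move=> T1T; rewrite cardsU disjoint_setI0 ?cards0 ?subn0 //.
  exact: disjointWr T1T AT.
apply/andP/idP => [[hA /eqP eAT]|hB]; last first.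
  have hAT' := bases_indep hB; split; first exact: indepS (subsetUl _ _) hAT'.
  rewrite eqn_leq rk_le_rank -(bases_card hB) leq_rk //.
  exact: setUS.
have [J [hJ AJ JT eJ]] := rk_indep hA (subsetUl A T).
have eJ2 : J = A :|: (J :&: T).
  apply/eqP; rewrite eqEsubset subUset AJ subsetIl !andbT.
  apply/subsetP => x xJ; have := subsetP JT x xJ.
  by rewrite 2!in_setU [x \in J :&: T]in_setI xJ.
apply/basesP; split; last by rewrite dAT'.
apply: (clone_indep cloneL (T1 := J :&: T)) => //.
- exact: subsetIr.
- by rewrite -(leq_add2l #|A|) -(dAT' _ (subsetIr J T)) -eJ2 eJ eAT eA.
- by rewrite -eJ2.
Qed.

Lemma spans_sandwich A B S : spans A -> spans S -> A \subset B -> B \subset S -> spans B.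
Proof.
move=> /andP[_ /eqP eA] /andP[hS _] AB BS.
rewrite /spans_with (indepS BS hS) eqn_leq rk_le_rank -eA rkS //.
exact: setSU.
Qed.

Lemma spans_card A : A \subset X -> spans A -> #|A| <= rank L <= #|A| + #|T|.
Proof.
move=> AX /andP[hA /eqP eA]; rewrite -(rk_cards hA) rk_le_rank -{1}eA.
exact: rkU.
Qed.

Lemma spans_bases2 S (T' : {set U}) x y : S \subset X -> T' \subset T ->
  #|S|.+2 + #|T'| = rank L -> x \in X :\: S -> y \in X :\: S -> x != y ->
  spans (x |: (y |: S)) = (x |: (y |: (S :|: T')) \in bases L).
Proof.
move=> SX T'T eS /setDP[xX xS] /setDP[yX yS] xy.
rewrite (@spans_bases _ T') -?setUA //; first by rewrite !subUset !sub1set xX yX.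
by rewrite !cardsU1 in_setU1 negb_or xy xS yS.
Qed.

(** Filling [S] up with a fixed subset of [T] of the missing size turns traces into bases, to which
    [noncrossing] applies. *)
Lemma spans_contract2 S a b : S \subset X ->
  a \in X :\: S -> b \in X :\: S -> a != b -> spans (a |: (b |: S)) ->
  exists Q : {set U}, #|Q|.+2 = rank L /\ forall x y, x \in X :\: S -> y \in X :\: S ->
    x != y -> spans (x |: (y |: S)) = (x |: (y |: Q) \in bases L).
Proof.
move=> SX /setDP[aX aS] /setDP[bX bS] ab hab.
have := spans_card _ hab; rewrite !subUset !sub1set aX bX SX => /(_ isT).
rewrite !cardsU1 in_setU1 negb_or ab aS bS !add1n => /andP[le1 le2].
have [|T' T'T eT'] := @subset_of_card T (rank L - #|S|.+2).
  by move: le2; clear; lia.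
have eS : #|S|.+2 + #|T'| = rank L by rewrite eT' subnKC.
exists (S :|: T'); split; last by move=> x y; apply: spans_bases2.
rewrite cardsU disjoint_setI0 ?cards0 ?subn0 -?eS ?addSn //.
exact: disjointWr T'T (X_disjoint SX).
Qed.

(** Here traces of two consecutive sizes occur; the smaller ones receive one further element [tau]
    of [T], which stands in for the point outside X. *)
Lemma spans_contract1 S a b d : S \subset X ->
  a \in X :\: S -> b \in X :\: S -> a != b -> d \in X :\: S ->
  spans (a |: (b |: S)) -> spans (d |: S) ->
  exists (Q : {set U}) tau, [/\ tau \in T, #|Q|.+2 = rank L,
    forall x, x \in X :\: S -> spans (x |: S) = (x |: (tau |: Q) \in bases L) &
    forall x y, x \in X :\: S -> y \in X :\: S -> x != y ->
      spans (x |: (y |: S)) = (x |: (y |: Q) \in bases L)].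
Proof.
move=> SX /setDP[aX aS] /setDP[bX bS] ab /setDP[dX dS] hab hd.
have := spans_card _ hab; rewrite !subUset !sub1set aX bX SX => /(_ isT).
rewrite !cardsU1 in_setU1 negb_or ab aS bS !add1n => /andP[le1 _].
have := spans_card _ hd; rewrite !subUset !sub1set dX SX => /(_ isT).
rewrite cardsU1 dS add1n => /andP[_ le2].
have [|T1 T1T eT1] := @subset_of_card T (rank L - #|S|.+1).
  by move: le2; clear; lia.
have [tau tauT1] : exists x, x \in T1.
  by apply/set0Pn; rewrite -card_gt0 eT1; move: le1; clear; lia.
have eT' : #|T1 :\ tau|.+1 = #|T1| by rewrite [RHS](cardsD1 tau) tauT1.
have T'T : T1 :\ tau \subset T := subset_trans (subsetDl _ _) T1T.
have eS : #|S|.+2 + #|T1 :\ tau| = rank L.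
  by move: eT' le1; rewrite eT1; clear; lia.
exists (S :|: T1 :\ tau), tau; split.
- exact: (subsetP T1T).
- rewrite cardsU disjoint_setI0 ?cards0 ?subn0 -?eS ?addSn //.
  exact: disjointWr T'T (X_disjoint SX).
- move=> x /setDP[xX xS]; rewrite (@spans_bases _ T1) // ?subUset ?sub1set ?xX //.
    by rewrite -setUA [tau |: _]setUCA setD1K.
  by rewrite cardsU1 xS -eT' -eS addnS addSn.
- by move=> x y; apply: spans_bases2.
Qed.

(* The four elements of a crossing that lie outside X are replaced by an
   element of T; this is harmless because X is an interval. *)
Lemma spans_cross (E S : {set U}) (lo hi : nat) a b c d : ground L \subset E ->
  (forall x, x \in E -> (x \in X) = (lo <= pos x < hi)) ->
  [/\ a \in E, b \in E, c \in E & d \in E] ->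
  a \notin S -> b \notin S -> c \notin S -> d \notin S -> cyc4 pos a b c d ->
  spans ((a |: (b |: S)) :&: X) -> spans ((c |: (d |: S)) :&: X) ->
  spans ((a |: (c |: S)) :&: X).
Proof.
move=> LE intX [aE bE cE dE] aS bS cS dS cyc.
have neq x y : pos x != pos y -> x != y by apply: contra_neq => ->.
have [ab [ac [ad [bc [bd cd]]]]] :
    a != b /\ a != c /\ a != d /\ b != c /\ b != d /\ c != d.
  by do !split; apply: neq; move: cyc; rewrite /cyc4 /btw; clear; lia.
have SX : S :&: X \subset X by apply: subsetIr.
have addX x (A : {set U}) : (x |: A) :&: X = if x \in X then x |: (A :&: X) else A :&: X.
  rewrite setIUl; case: ifP => xX; first by rewrite (setIidPl _) ?sub1set.
  by rewrite disjoint_setI0 ?set0U // disjoints1 xX.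
have nX x : x \notin S -> x \in X -> x \in X :\: (S :&: X).
  by move=> xS xX; rewrite in_setD xX in_setI (negPf xS).
(* The interval X contains one of the two arcs between any two of its points. *)
have bd_out : (b \in X) || (d \in X) || ~~ ((a \in X) && (c \in X)).
  rewrite !intX //; move: cyc; rewrite /cyc4 /btw; clear; lia.
have ac_out : (a \in X) || (c \in X) || ~~ ((b \in X) && (d \in X)).
  rewrite !intX //; move: cyc; rewrite /cyc4 /btw; clear; lia.
have tau_out tau : tau \in T -> (lo <= pos tau < hi) = false.
  have [TL _] := cloneL.
  by move=> tT; rewrite -intX ?(subsetP LE) ?(subsetP TL) // inE tT.
(* Seen from three points of the interval, all points outside it occupy the same cyclic place. *)
have cyc_out tau : tau \in T -> [/\
    (b \in X -> c \in X -> d \in X -> a \notin X -> cyc4 pos tau b c d),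
    (a \in X -> c \in X -> d \in X -> b \notin X -> cyc4 pos a tau c d),
    (a \in X -> b \in X -> d \in X -> c \notin X -> cyc4 pos a b tau d) &
    (a \in X -> b \in X -> c \in X -> d \notin X -> cyc4 pos a b c tau)].
  move=> /tau_out; rewrite !intX //; move: cyc; rewrite /cyc4 /btw; clear.
  by move=> *; split; lia.
rewrite !addX.
move: bd_out ac_out cyc_out (nX a aS) (nX b bS) (nX c cS) (nX d dS).
case: (a \in X); case: (b \in X); case: (c \in X); case: (d \in X) => //=;
  move=> _ _ cyc_out aX bX cX dX h1 h2.
- have [Q [eQ hQ]] := spans_contract2 SX (aX isT) (bX isT) ab h1.
  by move: h1 h2; rewrite !hQ ?aX ?bX ?cX ?dX //; apply: ncL.
- have [Q [tau [tT eQ hQ1 hQ2]]] :=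
    spans_contract1 SX (aX isT) (bX isT) ab (cX isT) h1 h2.
  move: h1 h2; rewrite !hQ2 ?aX ?bX ?cX // hQ1 ?cX //; apply: ncL => //.
  by case: (cyc_out tau tT) => _ _ _; apply.
- have [Q [tau [tT eQ hQ1 hQ2]]] :=
    spans_contract1 SX (aX isT) (bX isT) ab (dX isT) h1 h2.
  move: h1 h2; rewrite hQ2 ?aX ?bX // !hQ1 ?aX ?dX // => h1 h2.
  apply: (ncL eQ _ h1 (d := d)); last by rewrite setUCA.
  by case: (cyc_out tau tT) => _ _ + _; apply.
(* With [c] and [d] outside X, the wanted trace lies between the two given ones. *)
- by apply: (spans_sandwich h2 h1); rewrite ?subsetUr // setUS // subsetUr.
- have [Q [tau [tT eQ hQ1 hQ2]]] :=
    spans_contract1 SX (cX isT) (dX isT) cd (aX isT) h2 h1.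
  move: h1 h2; rewrite !hQ2 ?aX ?cX ?dX // hQ1 ?aX //; apply: ncL => //.
  by case: (cyc_out tau tT) => _ + _ _; apply.
- have [Q [tau [tT eQ hQ1 hQ2]]] :=
    spans_contract1 SX (cX isT) (dX isT) cd (bX isT) h2 h1.
  move: h1 h2; rewrite hQ2 ?cX ?dX // !hQ1 ?bX ?cX // => h1 h2.
  rewrite setUCA; apply: (ncL eQ _ _ h2 (b := b)); last by rewrite setUCA.
  by case: (cyc_out tau tT) => + _ _ _; apply.
- by apply: (spans_sandwich h1 h2); rewrite ?subsetUr // setUS // subsetUr.
Qed.

End Side.

Lemma noncrossing_free_amalgam (M N : matroid U) (T : {set U})
    (defT : T = ground M :&: ground N)
    (indepM : T \in indep M) (indepN : T \in indep N) (pos : U -> nat)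
    (lo hi lo' hi' : nat) :
  clone_set M T -> clone_set N T -> noncrossing pos M -> noncrossing pos N ->
  (forall x, x \in ground M :|: ground N ->
     (x \in ground M :\: T) = (lo <= pos x < hi)) ->
  (forall x, x \in ground M :|: ground N ->
     (x \in ground N :\: T) = (lo' <= pos x < hi')) ->
  noncrossing pos (free_amalgam defT indepM indepN).
Proof.
move=> cloneM cloneN ncM ncN intX intY S a b c d eS cyc.
set K := free_amalgam _ _ _ => hab hcd.
have nS x y : x |: (y |: S) \in bases K -> [/\ x != y, x \notin S & y \notin S].
  move=> /bases_card; rewrite !cardsU1 in_setU1 negb_or -eS.
  by case: (x != y) (x \in S) (y \in S) => [] [] [] //=; clear; lia.
have [_ aS bS] := nS _ _ hab; have [_ cS dS] := nS _ _ hcd.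
have ac : a != c.
  have : pos a != pos c by move: cyc; rewrite /cyc4 /btw; clear; lia.
  by apply: contra_neq => ->.
move: hab hcd; rewrite !bases_free_amalgam !subUset !sub1set.
move=> /and4P[/and3P[aE bE SE] _ abM abN] /and4P[/and3P[cE dE _] _ cdM cdN].
rewrite aE cE SE !cardsU1 in_setU1 negb_or ac aS cS -eS !add1n eqxx /=.
by apply/andP; split; [apply: (spans_cross cloneM ncM (subsetUl _ _) intX) cyc abM cdM
  | apply: (spans_cross cloneN ncN (subsetUr _ _) intY) cyc abN cdN].
Qed.

End Free.

(** * Positroids are the noncrossing matroids *)

Section FreeDets.
Variables (F : fieldType) (r : nat).
Local Open Scope ring_scope.

Lemma free_dets (V : seq 'rV[F]_r) : size V = r ->
  free [seq x^T | x <- V] = (dets V != 0).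
Proof.
move=> eV; have sX : size [seq x^T | x <- V] == r by rewrite size_map eV.
have comb (k : 'I_r -> F) :
    (\row_i k i *m \matrix_(i < r) V`_i)^T = \sum_i k i *: [seq x^T | x <- V]`_i.
  rewrite mulmx_sum_row linear_sum; apply: eq_bigr => i _.
  by rewrite linearZ mxE rowK (nth_map 0) ?eV.
apply/idP/idP => [/(@freeP _ _ r (Tuple sX)) fr|dN0].
  apply/negP => /det0P[u uN0 u0]; case/eqP: uN0; apply/rowP => i; rewrite mxE.
  apply: fr; rewrite -comb (_ : \row_i u 0 i = u) ?u0 ?linear0 //.
  by apply/rowP => j; rewrite mxE.
apply/(@freeP _ _ r (Tuple sX)) => k k0 i; apply/eqP; apply: contraNT dN0 => ki.
apply/det0P; exists (\row_i k i).
  by apply: contraNneq ki => /rowP/(_ i); rewrite !mxE => ->.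
by apply: trmx_inj; rewrite comb k0 linear0.
Qed.

End FreeDets.

Section Positroid.
Variables (R : realType) (U : finType).
Implicit Types (M K : matroid U) (t : seq U) (x y : U).
Local Open Scope ring_scope.

Lemma positroid_noncrossing M : positroid R M ->
  exists2 pos : U -> nat, injective pos & noncrossing pos M.
Proof.
case=> s [A [us sM repA minA]].
have mem_s x : (x \in s) = (x \in ground M) by have /setP/(_ x) := sM; rewrite inE.
(* The order must cover the ambient type; elements outside the ground set come last and get zero
   vectors. *)
pose pos x := if x \in s then index x s else (#|ground M| + enum_rank x)%N.
have pos_lt x : x \in s -> (pos x < #|ground M|)%N.
  by move=> xs; rewrite /pos xs -[X in (_ < X)%N](size_tuple s) index_mem.
have pos_inj : injective pos.
  move=> x y; case xs: (x \in s); case ys: (y \in s).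
  - by rewrite /pos xs ys => /index_inj; apply.
  - by move=> exy; have := pos_lt _ xs; rewrite exy /pos ys ltnNge leq_addr.
  - by move=> exy; have := pos_lt _ ys; rewrite -exy /pos xs ltnNge leq_addr.
  - by rewrite /pos xs ys => /addnI/ord_inj/enum_rank_inj.
exists pos => //.
pose v x : 'rV[R]_(rank M) := if insub (pos x) is Some j then (col j A)^T else 0.
have vE x (xs : x \in s) : v x = (col (Ordinal (pos_lt x xs)) A)^T.
  by rewrite /v (insubT (fun i => i < #|ground M|)%N (pos_lt x xs)).
have v0 x : x \notin s -> v x = 0.
  by move=> xs; rewrite /v insubF // /pos (negPf xs) ltnNge leq_addr.
apply: (noncrossing_rep (v := v)) => // t0 ut0 et0.
have [ts0|/allPn[x xt xs]] := boolP (all (fun x => x \in s) t0); last first.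
  rewrite (sminor0 pos_inj ut0 et0 xt (v0 _ xs)) lexx eqxx; split=> //.
  apply/esym/negP => /bases_indep/indep_ground/subsetP/(_ x).
  by rewrite inE -mem_s (negPf xs) => /(_ xt).
have [t [ut et st]] := sorted_enum pos_inj [set x in t0].
have pt : perm_eq t0 t.
  by apply: uniq_perm => // x; move/setP/(_ x): et; rewrite !inE => ->.
rewrite (perm_sminor pos_inj _ ut0 et0 pt) -et.
have {et}et : size t = rank M by rewrite -(perm_size pt).
have ts x : x \in t -> x \in s by rewrite -(perm_mem pt) => /(allP ts0).
rewrite /sminor inversions_sorted // expr0 mul1r.
pose tup := Tuple (introT eqP et).
have memt (i : 'I_(rank M)) : tnth tup i \in t.
  exact: mem_tnth.
pose f (i : 'I_(rank M)) : 'I_#|ground M| := Ordinal (pos_lt _ (ts _ (memt i))).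
have detE : dets (map v t) = \det (colsub f A).
  rewrite -[RHS]det_tr; congr (\det _); apply/matrixP => i j; rewrite !mxE.
  have x0 : U by exact: tnth tup i.
  have tE : nth x0 t i = tnth tup i by rewrite (tnth_nth x0).
  by rewrite (nth_map x0) ?et // tE (vE _ (ts _ (memt i))) !mxE.
split.
  rewrite detE; apply: minA => i j lt_ij /=.
  have x0 : U by exact: tnth tup i.
  have lt_size (k : 'I_(rank M)) : (k : nat) \in [pred n | (n < size (map pos t))%N].
    by rewrite inE size_map et.
  have := sorted_ltn_nth ltn_trans 0%N st _ _ (lt_size i) (lt_size j) lt_ij.
  by rewrite !(nth_map x0) ?et // !(tnth_nth x0).
have f_inj : injective f.
  have tup_inj : injective (tnth tup) by apply/tuple_uniqP.
  by move=> i j /(congr1 val) /= /pos_inj; apply: tup_inj.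
pose J : {set 'I_#|ground M|} := f @: setT.
have tnthf i : tnth s (f i) = tnth tup i.
  rewrite (tnth_nth (tnth tup i)) /=.
  by rewrite /pos ts // nth_index // ts.
have -> : [set x in t] = [set tnth s j | j in J].
  apply/setP => x; rewrite inE; apply/idP/imsetP => [xt|[j /imsetP[i _ ->] ->]].
    have /tnthP[i ->] : x \in tup by [].
    by exists (f i); rewrite ?tnthf // imset_f.
  by rewrite tnthf memt.
have cardJ : #|[set tnth s j | j in J]| = rank M.
  rewrite !card_imset ?cardsT ?card_ord //.
  exact/tuple_uniqP.
rewrite inE cardJ eqxx andbT repA -(free_dets (V := map v t)) ?size_map //.
rewrite -map_comp; apply/esym/perm_free.
have -> : [seq (trmx \o v) x | x <- t] = [seq col j A | j <- [seq f i | i <- enum 'I_(rank M)]].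
  have tE : map (tnth tup) (enum 'I_(rank M)) = t := map_tnth_enum tup.
  rewrite -map_comp -[in LHS]tE.
  rewrite -map_comp; apply: eq_map => i /=.
  by rewrite (vE _ (ts _ (memt i))) trmxK.
apply: perm_map; apply: uniq_perm; first exact: enum_uniq.
  by rewrite (map_inj_uniq f_inj); apply: enum_uniq.
move=> j; rewrite mem_enum; apply/imsetP/mapP => -[i _ ->]; exists i; rewrite ?mem_enum //.
Qed.

(** Minors control bases only, so a free list is completed to full size by vectors of a basis
    [B0]. *)
Lemma positive_rep_indep M (pos : U -> nat) (v : U -> 'rV[R]_(rank M)) t :
  positive_rep pos v (bases M) -> uniq t ->
  ([set x in t] \in indep M) = free [seq (v x)^T | x <- t].
Proof.
move=> rep.
have size_r (s : seq U) : uniq s -> size s = rank M ->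
    free [seq (v x)^T | x <- s] = ([set x in s] \in bases M).
  move=> us es; have [_ <-] := rep s us es.
  rewrite (map_comp trmx v) free_dets ?size_map // /sminor mulf_eq0 negb_or.
  by rewrite expf_neq0 // oppr_eq0 oner_eq0.
have size_set (s : seq U) : uniq s -> #|[set x in s]| = size s.
  by move=> us; rewrite cardsE; apply/card_uniqP.
move=> ut; apply/idP/idP => [/bases_ext[B hB tB]|ft].
  pose u := enum (B :\: [set x in t]).
  have utu : uniq (t ++ u).
    rewrite cat_uniq ut enum_uniq andbT /=; apply/hasPn => x.
    by rewrite mem_enum !inE => /andP[].
  have etu : [set x in t ++ u] = B.
    apply/setP => x; rewrite inE mem_cat mem_enum !inE.
    have := subsetP tB x; rewrite inE.
    by case: (x \in t) => [/(_ isT)->|_].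
  have : free [seq (v x)^T | x <- t ++ u].
    by rewrite size_r // ?etu // -(size_set _ utu) etu (bases_card hB).
  by rewrite map_cat; apply: catl_free.
have [n] := ubnP (rank M - size t)%N; elim: n t ut ft => // n IH t ut ft /ltnSE le_n.
have dimr : \dim {: 'cV[R]_(rank M)} = rank M by rewrite dimvf /= /dim /= muln1.
have le_r : (size t <= rank M)%N.
  move: (ft); rewrite /free size_map => /eqP <-; rewrite -[X in (_ <= X)%N]dimr.
  exact: dimvS (subvf _).
have [et|lt_r] := leqP (rank M) (size t).
  apply: bases_indep; rewrite -size_r //.
  by apply/eqP; rewrite eqn_leq le_r.
have [B0 hB0 _] := bases_ext (indep0 M).
have fB0 : free [seq (v x)^T | x <- enum B0].
  rewrite size_r ?enum_uniq //; last by rewrite -cardE (bases_card hB0).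
  by rewrite (_ : [set x in enum B0] = B0) //; apply/setP => x; rewrite inE mem_enum.
have /allPn[_ /mapP[x xB0 ->] xt] :
    ~~ all (fun w => w \in <<[seq (v x)^T | x <- t]>>%VS) [seq (v x)^T | x <- enum B0].
  apply: contraL lt_r => /allP sub; rewrite -leqNgt.
  have /dimvS : (<<[seq (v x)^T | x <- enum B0]>> <=
      <<[seq (v x)^T | x <- t]>>)%VS by apply/span_subvP.
  move: (fB0) (ft); rewrite /free => /eqP -> /eqP ->.
  by rewrite !size_map -cardE (bases_card hB0).
have xnt : x \notin t.
  by apply: contra xt => xt; apply: memv_span; apply: (map_f (fun y => (v y)^T)).
apply: (@indepS _ _ [set y in x :: t]).
  by apply/subsetP => y; rewrite !inE => ->; rewrite orbT.
apply: IH; first by rewrite /= xnt.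
  by rewrite /= free_cons xt ft.
by rewrite /= subnS -ltnS prednK ?subn_gt0.
Qed.

Lemma noncrossing_positroid K (pos : U -> nat) :
  injective pos -> noncrossing pos K -> positroid R K.
Proof.
move=> pos_inj nc; have [v rep] := realization R pos_inj nc.
have [s [us es ss]] := sorted_enum pos_inj (ground K).
have sz : size s == #|ground K| by rewrite -es cardsE (card_uniqP us).
pose st := Tuple sz.
have st_inj : injective (tnth st) by apply/tuple_uniqP.
exists st, (\matrix_(i, j) v (tnth st j) 0 i); split=> //.
- move=> J; pose t := [seq tnth st j | j <- enum J].
  have -> : [set tnth st j | j in J] = [set x in t].
    apply/setP => x; rewrite inE; apply/imsetP/mapP => -[j jJ ->]; exists j => //.
      by rewrite mem_enum.
    by rewrite mem_enum in jJ.
  rewrite (positive_rep_indep rep); last by rewrite map_inj_uniq ?enum_uniq.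
  rewrite -map_comp; congr free; apply: eq_map => j /=.
  by apply/matrixP => i k; rewrite !mxE ord1.
move=> f f_homo; set A := colsub f _.
pose t := [seq tnth st (f i) | i <- enum 'I_(rank K)].
have f_inj : injective f.
  move=> i j eij; apply: val_inj.
  by case: (ltngtP (i : nat) j) => // /f_homo; rewrite eij ltnn.
have ut : uniq t by rewrite map_inj_uniq ?enum_uniq // => i j /st_inj/f_inj.
have zt : size t = rank K by rewrite size_map size_enum_ord.
have [] := rep t ut zt.
have sorted_t : sorted ltn (map pos t).
  rewrite -map_comp; apply: (@homo_sorted _ _ _ (relpre val ltn)); last first.
    by rewrite -sorted_map val_enum_ord iota_ltn_sorted.
  move=> i j /f_homo lt_f /=.
  have lt_s (k : 'I_#|ground K|) : (k : nat) \in [pred n | (n < size (map pos s))%N].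
    by rewrite inE size_map (eqP sz).
  have := sorted_ltn_nth ltn_trans 0%N ss _ _ (lt_s (f i)) (lt_s (f j)) lt_f.
  have x0 := tnth st (f i).
  by rewrite !(nth_map x0) ?(eqP sz) // !(tnth_nth x0).
rewrite /sminor inversions_sorted // expr0 mul1r => le _.
suff -> : \det A = dets (map v t) by [].
rewrite -det_tr; congr (\det _); apply/matrixP => i j; rewrite !mxE.
by rewrite -map_comp (nth_map i) ?size_enum_ord // nth_ord_enum.
Qed.

End Positroid.

(** * A common order for both ground sets *)

Section CommonOrder.
Variables (U : finType) (M N : matroid U) (T : {set U}) (tau : U).
Hypotheses (defT : T = ground M :&: ground N) (tauT : tau \in T).
Variables (pM pN : U -> nat).
Hypotheses (pM_inj : injective pM) (pN_inj : injective pN).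
Hypotheses (pM_tau : pM tau = 0) (pN_tau : pN tau = 0).

Let LM := (\max_x pM x).+1.
Let LN := LM + #|U|.
Let L := LN + (\max_x pN x).+1.

(** Since [tau] has position 0 in both orders, the block [T] may follow the rest of M and precede
    the rest of N: on a circle both are the place of [tau]. The width #|U| of the block makes room
    for [enum_rank]. *)
Definition common_order x : nat :=
  if x \in T then LM + enum_rank x
  else if x \in ground M then pM x
  else if x \in ground N then LN + pN x
  else L + enum_rank x.

Lemma common_order_spec x :
  [\/ [/\ x \in T, common_order x = LM + enum_rank x & enum_rank x < #|U|],
      [/\ x \in ground M :\: T, common_order x = pM x & 0 < pM x < LM],
      [/\ x \in ground N :\: T, common_order x = LN + pN x & 0 < pN x < L - LN] |
      [/\ x \notin ground M, x \notin ground N & common_order x = L + enum_rank x]].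
Proof.
have hM : pM x < LM by rewrite ltnS; apply: leq_bigmax.
have hN : pN x < L - LN by rewrite addKn ltnS; apply: leq_bigmax.
have posM : x \notin T -> 0 < pM x.
  move=> xT; rewrite lt0n -pM_tau; apply: contraNneq xT => /pM_inj ->.
  exact: tauT.
have posN : x \notin T -> 0 < pN x.
  move=> xT; rewrite lt0n -pN_tau; apply: contraNneq xT => /pN_inj ->.
  exact: tauT.
rewrite /common_order !in_setD; case: ifP => [xT|/negbT xT].
  by apply: Or41; rewrite ltn_ord.
case: ifP => [xM|xM]; first by apply: Or42; rewrite posM.
case: ifP => [xN|xN]; first by apply: Or43; rewrite posN.
by apply: Or44.
Qed.

Lemma common_order_inj : injective common_order.
Proof.
move=> x y; have eLN : LN = LM + #|U| by [].
have leL : LN <= L by apply: leq_addr.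
case: (common_order_spec x) => [[_ -> ?]|[_ -> ?]|[_ -> ?]|[_ _ ->]];
  case: (common_order_spec y) => [[_ -> ?]|[_ -> ?]|[_ -> ?]|[_ _ ->]];
  try (by move/addnI/ord_inj/enum_rank_inj); try exact: pM_inj;
  try (by move/addnI/pN_inj); lia.
Qed.

Lemma common_order_M x : x \in ground M ->
  if x \in T then LM <= common_order x < LN
  else (common_order x == pM x) && (0 < pM x < LM).
Proof.
move=> xM; case: (common_order_spec x) => [[-> -> h]|[/setDP[_ xT] -> h]|[/setDP[xN]]|[]].
- by rewrite leq_addr /LN ltn_add2l.
- by rewrite (negPf xT) eqxx.
- by rewrite defT inE xM xN.
- by rewrite xM.
Qed.

Lemma common_order_N x : x \in ground N ->
  if x \in T then LM <= common_order x < LN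
  else (common_order x == LN + pN x) && (0 < pN x < L - LN).
Proof.
move=> xN; case: (common_order_spec x) => [[-> -> h]|[/setDP[xM]]|[/setDP[_ xT] -> h]|[]].
- by rewrite leq_addr /LN ltn_add2l.
- by rewrite defT inE xM xN.
- by rewrite (negPf xT) eqxx.
- by rewrite xN.
Qed.

Lemma noncrossing_common_M : clone_set M T -> noncrossing pM M ->
  noncrossing common_order M.
Proof.
move=> cloneM; apply: (noncrossing_clones cloneM tauT) => [a b c aM bM cM|a b c d aT cT bM dM].
  move: (common_order_M aM) (common_order_M bM) (common_order_M cM).
  have : LM <= LN by apply: leq_addr.
  case: (a \in T); case: (b \in T); case: (c \in T) => leM;
    rewrite /= !inE ?eqxx ?orbT ?andbF //= => Ha Hb Hc _; rewrite /btw ?pM_tau;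
    move: Ha Hb Hc leM; clear; lia.
have [aM cM] : a \in ground M /\ c \in ground M.
  by move: aT cT; rewrite defT !inE => /andP[-> _] /andP[-> _].
move: (common_order_M aM) (common_order_M bM) (common_order_M cM) (common_order_M dM).
rewrite aT cT; case: (b \in T) => //; case: (d \in T) => //.
by rewrite /cyc4 /btw; clear; lia.
Qed.

Lemma noncrossing_common_N : clone_set N T -> noncrossing pN N ->
  noncrossing common_order N.
Proof.
move=> cloneN; apply: (noncrossing_clones cloneN tauT) => [a b c aM bM cM|a b c d aT cT bM dM].
  move: (common_order_N aM) (common_order_N bM) (common_order_N cM).
  have : LM <= LN by apply: leq_addr.
  case: (a \in T); case: (b \in T); case: (c \in T) => leM;
    rewrite /= !inE ?eqxx ?orbT ?andbF //= => Ha Hb Hc _; rewrite /btw ?pN_tau;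
    move: Ha Hb Hc leM; clear; lia.
have [aM cM] : a \in ground N /\ c \in ground N.
  by move: aT cT; rewrite defT !inE => /andP[_ ->] /andP[_ ->].
move: (common_order_N aM) (common_order_N bM) (common_order_N cM) (common_order_N dM).
rewrite aT cT; case: (b \in T) => //; case: (d \in T) => //.
by rewrite /cyc4 /btw; clear; lia.
Qed.

Lemma common_order_interval : exists lo hi lo' hi',
  (forall x, x \in ground M :|: ground N ->
     (x \in ground M :\: T) = (lo <= common_order x < hi)) /\
  (forall x, x \in ground M :|: ground N ->
     (x \in ground N :\: T) = (lo' <= common_order x < hi')).
Proof.
have le1 : LM <= LN by apply: leq_addr.
have le2 : LN <= L by apply: leq_addr.
exists 0, LM, LN, L; split=> x; rewrite in_setU in_setD.
  have [xM _|_ /= xN] := boolP (x \in ground M).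
    by have := common_order_M xM; case: (x \in T) => /=; move: le1; clear; lia.
  by have := common_order_N xN; case: (x \in T) => /=; move: le1; clear; lia.
have [xN _|_] := boolP (x \in ground N).
  by have := common_order_N xN; case: (x \in T) => /=; move: le1 le2; clear; lia.
rewrite orbF => xM.
by have := common_order_M xM; case: (x \in T) => /=; move: le1; clear; lia.
Qed.

End CommonOrder.

Theorem theorem4p17 (R : realType) (U : finType) (M N : matroid U)
    (T : {set U}) (defT : T = ground M :&: ground N)
    (posM : positroid R M) (posN : positroid R N)
    (loopM : loopless M) (loopN : loopless N)
    (T_neq0 : T != set0)
    (indepM : T \in indep M)
    (indepN : T \in indep N)
    (cloneM : clone_set M T)
    (cloneN : clone_set N T) :
  exists K : matroid U, is_free_amalgam M N K /\ positroid R K.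
Proof.
have [tau tauT] := set0Pn _ T_neq0.
have [pM pM_inj ncM] := positroid_noncrossing posM.
have [pN pN_inj ncN] := positroid_noncrossing posN.
exists (free_amalgam defT indepM indepN); split.
  exact: free_amalgam_is_free.
(* Both circles are cut at the common element [tau], where they will be glued. *)
pose pM' := rot_pos pM tau; pose pN' := rot_pos pN tau.
have pM'_inj : injective pM' by apply: rot_pos_inj.
have pN'_inj : injective pN' by apply: rot_pos_inj.
have pM'_tau : pM' tau = 0 by apply: rot_pos_self.
have pN'_tau : pN' tau = 0 by apply: rot_pos_self.
have {}ncM : noncrossing pM' M by apply/noncrossing_rot.
have {}ncN : noncrossing pN' N by apply/noncrossing_rot.
have [lo [hi [lo' [hi' [intX intY]]]]] :=
  common_order_interval defT tauT pM'_inj pN'_inj pM'_tau pN'_tau.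
apply: (@noncrossing_positroid _ _ _ (common_order M N T pM' pN')).
  exact: (common_order_inj tauT).
apply: noncrossing_free_amalgam intX intY => //.
  exact: (noncrossing_common_M defT tauT).
exact: (noncrossing_common_N defT tauT).
Qed.
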